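(* Let $(X,T)$ be a topological dynamical system with induced system $(\mathscr M(X),T_* )$. Let $\mathrm{scl}=\{\mathrm{scl}_\alpha\}_{\alpha\ge0}$ be a scaling, put $a_\alpha(n)=-\log\mathrm{scl}_\alpha(e^{-n})$, and let $$\mathcal B_{\log}=\Bigl\{\alpha>0:\ \text{there is no }\beta\in(0,\alpha)\text{ with }\lim_{n\to\infty}\frac{a_\beta(n)\log(n+1)}{a_\alpha(n)}=0\Bigr\}.$$ Suppose that either $\mathcal B_{\log}=\emptyset$, or $\mathcal B_{\log}\ne\emptyset$ and $$\inf_{\gamma>0}\limsup_{n\to\infty}\frac{a_\gamma(n)}{n}=0,\qquad \liminf_{n\to\infty}\frac{a_\alpha(n)}{n}>0\ \text{ for every }\alpha\in\mathcal B_{\log}.$$ Then $$\overline D^{\mathrm{seq}}_{\mathrm{scl}}(X,T)=\overline D^{\mathrm{seq}}_{\mathrm{scl}}(\mathscr M(X),T_* ).$$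
   Context: A topological dynamical system $(X,T)$ consists of a compact metric space $(X,d)$ and a continuous map $T:X\to X$. $\mathscr M(X)$ is the space of Borel probability measures on $X$ with the weak-$*$ topology (compact metrizable), and $T_*\mu=\mu\circ T^{-1}$; $(\mathscr M(X),T_* )$ is regarded as a topological dynamical system with any compatible metric (the quantities below do not depend on the choice). A scaling is a family $\mathrm{scl}=(\mathrm{scl}_\alpha)_{\alpha\ge0}$ of positive non-decreasing functions on $(0,1)$ such that for all $\alpha>\beta>0$ and every $\lambda>1$ sufficiently close to $1$, $\mathrm{scl}_\alpha(\epsilon)=o(\mathrm{scl}_\beta(\epsilon^\lambda))$ and $\mathrm{scl}_\alpha(\epsilon)=o(\mathrm{scl}_\beta(\epsilon)^\lambda)$ as $\epsilon\to0^+$. Standing assumption: $\lim_{\epsilon\to0}\mathrm{scl}_\alpha(\epsilon)=0$ for every $\alpha>0$. For an increasing sequence $\mathsf S=\{t_1<t_2<\cdots\}$ of non-negative integers put $d^{\mathsf S}_n(x,y)=\max_{1\le j\le n}d(T^{t_j}x,T^{t_j}y)$ and let $s^{\mathsf S}_n(X,d,\epsilon)$ be the maximal cardinality of a set $E\subset X$ with $d^{\mathsf S}_n(x,y)\ge\epsilon$ for all distinct $x,y\in E$. Put $\overline\Lambda^{\mathsf S}_{\mathrm{scl}_\alpha}(T,X,d)=\lim_{\epsilon\to0^+}\limsup_{n\to\infty}s^{\mathsf S}_n(X,d,\epsilon)\,\mathrm{scl}_\alpha(e^{-n})$ and $\overline h^{C}_{\mathrm{scl},\mathsf S}(T,X)=\inf\{\alpha>0:\overline\Lambda^{\mathsf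 S}_{\mathrm{scl}_\alpha}(T,X,d)=0\}=\sup\{\alpha>0:\overline\Lambda^{\mathsf S}_{\mathrm{scl}_\alpha}(T,X,d)=+\infty\}$ (the two agree; $\sup\emptyset=0$, $\inf\emptyset=+\infty$). The upper dimension of $\mathsf S$ is $\overline D(\mathsf S)=\inf\{\tau\ge0:\limsup_{n\to\infty}n/t_n^\tau=0\}$. Let $\mathcal P_{\mathrm{scl}}(X,T)$ be the set of increasing sequences $\mathsf S$ with $\overline h^{C}_{\mathrm{scl},\mathsf S}(T,X)>0$. The upper positive-sequence dimension is $\overline D^{\mathrm{seq}}_{\mathrm{scl}}(X,T)=\sup_{\mathsf S\in\mathcal P_{\mathrm{scl}}(X,T)}\overline D(\mathsf S)$ if $\mathcal P_{\mathrm{scl}}(X,T)\ne\emptyset$, and $0$ otherwise. The same definitions apply to $(\mathscr M(X),T_* )$. *)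

(* Defs.v *)
From HB Require Import structures.
From mathcomp Require Import all_boot all_order all_algebra.
From mathcomp Require Import all_classical all_reals all_analysis.

Set Implicit Arguments.
Unset Strict Implicit.
Unset Printing Implicit Defensive.

Import Order.TTheory GRing.Theory Num.Theory.
Import numFieldNormedType.Exports.

Local Open Scope classical_set_scope.
Local Open Scope ring_scope.

(* Measurable types are pointed in the library, hence pointed metric spaces. *)
#[short(type="pmetricType")]
HB.structure Definition PointedMetric (K : numDomainType) :=
  {M of PseudoPointedMetric K M & PseudoMetric_isMetric K M}.

Record scaling (R : realType) (scl : R -> R -> R) : Prop := Scaling {
  scaling_gt0 : forall a e : R, 0 <= a -> 0 < e < 1 -> 0 < scl a e ;
  scaling_nondecreasing : forall a e1 e2 : R,
    0 <= a -> 0 < e1 -> e1 <= e2 -> e2 < 1 -> scl a e1 <= scl a e2 ;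
  scaling_littleo : forall a b : R, 0 < b -> b < a ->
    \forall l \near 1^'+,
      (scl a =o_ (0^'+) (fun e : R => scl b (e `^ l))) /\
      (scl a =o_ (0^'+) (fun e : R => scl b e `^ l)) ;
  scaling_cvg0 : forall a : R, 0 < a -> scl a e @[e --> 0^'+] --> 0
}.

Definition scl_exponent (R : realType) (scl : R -> R -> R) (a : R) (n : nat) : R :=
  - ln (scl a (expR (- n%:R))).

Definition B_log (R : realType) (scl : R -> R -> R) : set R :=
  [set a | 0 < a /\
    ~ exists b : R, 0 < b < a /\
      (scl_exponent scl b n * ln n.+1%:R / scl_exponent scl a n) @[n --> \oo]
        --> (0 : R)].

(* A sequence t_1 < t_2 < ... is encoded by [S : nat -> nat] with
   [t_j = S j.-1], so that [t_1, ..., t_n] are the [S j] with [j < n]. *)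

Section SequenceEntropy.
Variables (R : realType) (Y : Type) (d : Y -> Y -> R) (T : Y -> Y).
Variable scl : R -> R -> R.

(* The default value [0] is only reached for [n = 0], as [d] is nonnegative. *)
Definition seq_dist (S : nat -> nat) (n : nat) (x y : Y) : R :=
  \big[Num.max/0]_(j < n) d (iter (S j) T x) (iter (S j) T y).

Definition seq_separated (S : nat -> nat) (n : nat) (e : R) (E : set Y) : Prop :=
  forall x y, E x -> E y -> x <> y -> e <= seq_dist S n x y.

(* The maximal cardinality is a supremum in [\bar R]: it is attained (and
   finite) on a compact space. *)
Definition sep_number (S : nat -> nat) (n : nat) (e : R) : \bar R :=
  ereal_sup [set k%:R%:E | k in
    [set k : nat | exists E : set Y, (E #= `I_k)%card /\ seq_separated S n e E]].

Definition upper_Lambda (S : nat -> nat) (a : R) : \bar R :=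
  lim ((limn_esup (fun n =>
          sep_number S n e * (scl a (expR (- n%:R)))%:E)%E) @[e --> 0^'+]).

Definition upper_seq_entropy (S : nat -> nat) : \bar R :=
  ereal_inf [set a%:E | a in [set a : R | 0 < a /\ upper_Lambda S a = 0%E]].

Definition positive_seqs : set (nat -> nat) :=
  [set S | increasing_seq S /\ (0 < upper_seq_entropy S)%E].

End SequenceEntropy.

(* [n / t_n ^ tau] for [n >= 1], shifted by one. *)
Definition upper_dim (R : realType) (S : nat -> nat) : \bar R :=
  ereal_inf [set tau%:E | tau in [set tau : R | 0 <= tau /\
    limn_esup (fun n => (n.+1%:R / (S n)%:R `^ tau)%:E) = 0%E]].

Definition upper_seq_dim (R : realType) (Y : Type) (d : Y -> Y -> R)
    (T : Y -> Y) (scl : R -> R -> R) : \bar R :=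
  if `[< positive_seqs d T scl !=set0 >]
  then ereal_sup [set upper_dim R S | S in positive_seqs d T scl]
  else 0%E.

Definition borel (X : ptopologicalType) : Type := g_sigma_algebraType (@open X).
HB.instance Definition _ (X : ptopologicalType) := Measurable.on (borel X).

(* A library measure is a function on all sets, unconstrained outside the
   sigma-algebra. Requiring it to vanish there makes two elements equal as soon
   as they agree on Borel sets, see [borel_prob_ext]. *)
Record borel_prob (R : realType) (X : ptopologicalType) := BorelProb {
  bp_val :> probability (borel X) R ;
  bp_out : forall A : set (borel X), ~ measurable A -> bp_val A = 0%E
}.

HB.instance Definition _ (R : realType) (X : ptopologicalType) :=
  gen_eqMixin (borel_prob R X).
HB.instance Definition _ (R : realType) (X : ptopologicalType) :=
  gen_choiceMixin (borel_prob R X).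

Lemma borel_prob_ext (R : realType) (X : ptopologicalType)
    (mu nu : borel_prob R X) :
  (forall A : set (borel X), measurable A -> mu A = nu A) -> mu = nu.
Proof.
move=> munu.
have e : mu = nu :> (set (borel X) -> \bar R).
  apply/funext => A; case: (pselect (measurable A)) => [|mA]; first exact: munu.
  by rewrite !bp_out.
case: mu nu munu e => [[mu cmu] mu0] [[nu cnu] nu0] /= _ e.
subst nu.
have c : cmu = cnu.
  case: cmu {mu0} => [[a0 a1] [a2] [a3] [a4] [a5] [a6] [a7]].
  case: cnu {nu0} => [[b0 b1] [b2] [b3] [b4] [b5] [b6] [b7]].
  by rewrite (Prop_irrelevance b0 a0) (Prop_irrelevance b1 a1)
    (Prop_irrelevance b2 a2) (Prop_irrelevance b3 a3) (Prop_irrelevance b4 a4)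
    (Prop_irrelevance b5 a5) (Prop_irrelevance b6 a6) (Prop_irrelevance b7 a7).
by subst cnu; congr BorelProb; exact: Prop_irrelevance.
Qed.

(* The Borel probability measure obtained from an arbitrary library one. *)
Section BorelRestriction.
Variables (R : realType) (X : ptopologicalType) (P : probability (borel X) R).

Definition borel_restr (A : set (borel X)) : \bar R :=
  if `[< measurable A >] then P A else 0%E.

Lemma borel_restrE A : measurable A -> borel_restr A = P A.
Proof. by move=> mA; rewrite /borel_restr asboolT. Qed.

Let borel_restr0 : borel_restr set0 = 0%E.
Proof. by rewrite borel_restrE. Qed.

Let borel_restr_ge0 A : (0 <= borel_restr A)%E.
Proof. by rewrite /borel_restr; case: ifP. Qed.

Let borel_restr_sigma_additive : semi_sigma_additive borel_restr.
Proof.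
move=> F mF tF mUF; rewrite borel_restrE//.
under eq_fun do under eq_bigr do rewrite borel_restrE//.
exact: measure_semi_sigma_additive.
Qed.

HB.instance Definition _ := isMeasure.Build _ _ _ borel_restr
  borel_restr0 borel_restr_ge0 borel_restr_sigma_additive.

Let borel_restrT : borel_restr setT = 1%E.
Proof. by rewrite borel_restrE// probability_setT. Qed.

HB.instance Definition _ :=
  Measure_isProbability.Build _ _ _ borel_restr borel_restrT.

Lemma borel_restr_out A : ~ measurable A -> borel_restr A = 0%E.
Proof. by move=> mA; rewrite /borel_restr asboolF. Qed.

Definition to_borel_prob : borel_prob R X := BorelProb borel_restr_out.

End BorelRestriction.

Section Induced.
Variables (R : realType) (X : ptopologicalType) (T : X -> X).
Hypothesis cT : continuous T.

Let bT : borel X -> borel X := T.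

Lemma continuous_measurable_borel : measurable_fun setT bT.
Proof.
apply: (@measurability _ _ (borel X) (borel X) setT bT (@open X)) => // _ [B oB <-].
by rewrite setTI; apply: sub_sigma_algebra; exact: open_comp.
Qed.

HB.instance Definition _ :=
  isMeasurableFun.Build _ _ _ _ bT continuous_measurable_borel.

Definition induced_map (mu : borel_prob R X) : borel_prob R X :=
  to_borel_prob (distribution mu bT).

Lemma induced_mapE (mu : borel_prob R X) (A : set (borel X)) :
  measurable A -> induced_map mu A = mu (T @^-1` A).
Proof. exact: borel_restrE. Qed.

End Induced.

(* The weak-* topology: the coarsest one making [mu |-> \int f dmu] continuous
   for every continuous [f : X -> R]. *)
Definition integral_against (R : realType) (X : ptopologicalType)
    (mu : borel_prob R X) : {ptws continuousType X R -> R} :=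
  fun f => \int[mu]_(x in setT) (f : borel X -> R) x.

HB.instance Definition _ (R : realType) (X : ptopologicalType) :=
  Topological.copy (borel_prob R X)
    (initial_topology (@integral_against R X)).

Record compatible_metric (R : realType) (M : topologicalType) (d : M -> M -> R)
    : Prop := CompatibleMetric {
  cmetricxx : forall x, d x x = 0 ;
  cmetric_positivity : forall x y, d x y = 0 -> x = y ;
  cmetric_sym : forall x y, d x y = d y x ;
  cmetric_triangle : forall y x z, d x z <= d x y + d y z ;
  cmetric_open : forall A : set M, open A <->
    forall x, A x -> exists2 e : R, 0 < e & [set y | d x y < e] `<=` A
}.

(* Main.v *)
(* The two systems have the same sets of positive sequences. Dirac masses embed
   [X] in the space of measures, which gives one inclusion. For the other, a
   compatible metric is controlled by integrals of finitely many continuous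
   functions, so a measure is seen, along the first [n] times, as a point of the
   convex hull of [N = O(n)]-dimensional vectors indexed by [X]. Averages of [k]
   sample points approximate such a point: in the sup norm for [k ~ log N], and
   in normalised l2 norm for a [k] independent of [N]. Counting the samples among
   [m] net points of [X] bounds the number of separated measures by [m ^ O(log n)],
   respectively by [m ^ k * exp (small * n)]. The first bound suffices outside
   [B_log], the second one in the exponential regime imposed on [B_log].
   Compactness of the space of measures is obtained by coding [X] by the Cantor
   space and realising the limit of an ultrafilter of measures as the image of
   Lebesgue measure on [[0, 1[]. *)
From HB Require Import structures.
Require Import Defs.
From mathcomp Require Import all_boot all_order all_algebra.
From mathcomp Require Import all_classical all_reals all_analysis.
From mathcomp Require Import lra.
Import Order.TTheory GRing.Theory Num.Theory.
Import numFieldNormedType.Exports.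
Local Open Scope classical_set_scope.
Local Open Scope ring_scope.

Set Implicit Arguments.
Unset Strict Implicit.
Unset Printing Implicit Defensive.

(** * Sampling points of a convex hull *)

Lemma sumr_constT (R : realType) (J : finType) (x : R) :
  \sum_(j : J) x = x *+ #|J|.
Proof. by rewrite -sumr_const; apply: eq_bigl. Qed.

Section Empirical.
Variables (R : realType) (J : finType) (Y : Type) (g : J -> Y -> R).
Hypothesis g_le1 : forall j y, `|g j y| <= 1.

(* For finite [J] this says that [v] lies in the closed convex hull of the
   vectors [g ^~ y]. *)
Definition in_hull (v : J -> R) : Prop :=
  forall c : J -> R, exists y, \sum_j c j * (g j y - v j) <= 0.

Lemma in_hull_le1 (v : J -> R) j : in_hull v -> `|v j| <= 1.
Proof.
move=> hv; rewrite ler_norml.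
have [y] := hv (fun i => (i == j)%:R).
rewrite (bigD1 j) //= eqxx /= ?mulN1r ?mul1r big1 ?addr0; last first.
  by move=> i /negPf ->; rewrite mul0r.
have [z] := hv (fun i => - (i == j)%:R).
rewrite (bigD1 j) //= eqxx /= ?mulN1r ?mul1r big1 ?addr0; last first.
  by move=> i /negPf ->; rewrite oppr0 mul0r.
have := g_le1 j y; have := g_le1 j z; rewrite !ler_norml => /andP[? ?] /andP[? ?].
by move=> ? ?; apply/andP; split; lra.
Qed.

Lemma in_hull_dev (v : J -> R) j y : in_hull v -> `|g j y - v j| <= 2.
Proof.
move=> /(@in_hull_le1 v j); have := g_le1 j y; rewrite !ler_norml.
by move=> /andP[? ?] /andP[? ?]; apply/andP; split; lra.
Qed.

(** Greedy choice: with the running sum of deviations as coefficients, the hull property gives a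
    sample whose deviation has nonpositive inner product with that sum. The squared norm then grows
    by at most [4 * #|J|] per sample, since deviations are bounded by 2. *)
Lemma hull_sample_l2 (v : J -> R) k : in_hull v ->
  exists2 s : seq Y, size s = k &
    \sum_j (\sum_(y <- s) (g j y - v j)) ^+ 2 <= 4 * k%:R * #|J|%:R.
Proof.
move=> hv; elim: k => [|k [s <- hs]].
  exists [::] => //; rewrite mulr0 mul0r big1 // => j _.
  by rewrite big_nil expr0n.
have [y hy] := hv (fun j => \sum_(y <- s) (g j y - v j)).
exists (y :: s) => //.
under eq_bigr do rewrite big_cons.
have h2 : \sum_(j : J) (2 : R) ^+ 2 = 4 * #|J|%:R.
  by rewrite sumr_constT mulr_natr; congr (_ *+ _); lra.
apply: (@le_trans _ _ (\sum_j (2 ^+ 2 + 2 *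
   ((\sum_(z <- s) (g j z - v j)) * (g j y - v j)) +
   (\sum_(z <- s) (g j z - v j)) ^+ 2))).
  apply: ler_sum => j _; rewrite sqrrD lerD2r -mulr_natl.
  rewrite [X in 2%:R * X]mulrC lerD2r.
  rewrite -[leLHS]ger0_norm ?sqr_ge0 // normrX lerXn2r ?nnegrE //.
  exact: in_hull_dev.
rewrite !big_split /= h2 -mulr_sumr.
set B := \sum_j _ in hy *; move: hs; set A := \sum_j _ => hA.
by rewrite -[(size s).+1%:R]natr1; lra.
Qed.

(** With z = y - 2y^2, use exp(-z) >= 1 - z > 0 and (1 + y)(1 - z) = 1 + y^2 (1 + 2y) >= 1. *)
Lemma expR_sub_sqr_le (y : R) : `|y| <= 1 / 2 -> expR (y - 2 * y ^+ 2) <= 1 + y.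
Proof.
rewrite ler_norml => /andP[y1 y2].
have h : 1 - (y - 2 * y ^+ 2) <= expR (- (y - 2 * y ^+ 2)) by exact: expR_ge1Dx.
have p : 0 < 1 - (y - 2 * y ^+ 2) by nra.
rewrite -(ler_pM2r p); apply: (@le_trans _ _ 1); last by nra.
rewrite -[leRHS](expRxMexpNx_1 (y - 2 * y ^+ 2)).
by rewrite ler_wpM2l ?expR_ge0.
Qed.

(** Applied factor by factor, the previous bound loses 2(tx)^2, which is at most 8t^2 when |x| <=
    2. *)
Lemma expR_sum_le_prod (t : R) (s : seq R) :
  0 <= t <= 1 / 4 -> (forall x, x \in s -> `|x| <= 2) ->
  expR (t * \sum_(x <- s) x - 8 * t ^+ 2 * (size s)%:R) <=
    \prod_(x <- s) (1 + t * x).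
Proof.
move=> /andP[t0 t4]; elim: s => [|x s ih] hs.
  by rewrite !big_nil !mulr0 subr0 expR0.
rewrite !big_cons /=.
have x2 : `|x| <= 2 by apply: hs; rewrite mem_head.
have tx : `|t * x| <= 1 / 2.
  by rewrite normrM ger0_norm //; have := normr_ge0 x; nra.
have e : t * (x + \sum_(z <- s) z) - 8 * t ^+ 2 * (size s).+1%:R =
   (t * x - 8 * t ^+ 2) + (t * \sum_(z <- s) z - 8 * t ^+ 2 * (size s)%:R).
  by rewrite -[(size s).+1%:R]natr1; lra.
rewrite e expRD ler_pM ?expR_ge0 //; last first.
  by apply: ih => z zs; apply: hs; rewrite in_cons zs orbT.
apply: le_trans (expR_sub_sqr_le tx); rewrite ler_expR.
rewrite lerD2l lerN2 exprMn.
have : x ^+ 2 <= 2 ^+ 2.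
  by rewrite -[leLHS]ger0_norm ?sqr_ge0 // normrX lerXn2r ?nnegrE.
have := sqr_ge0 t; nra.
Qed.

(* The potential [\sum_j (\prod (1 + t Y_j) + \prod (1 - t Y_j))] starts at
   [2 #|J|] and never has to increase, because its increment is linear in the
   new sample. *)
Lemma hull_sample_potential (v : J -> R) (t : R) k : in_hull v ->
  exists2 s : seq Y, size s = k &
    \sum_j (\prod_(y <- s) (1 + t * (g j y - v j)) +
            \prod_(y <- s) (1 + t * - (g j y - v j))) <= 2 * #|J|%:R.
Proof.
move=> hv; elim: k => [|k [s <- hs]].
  exists [::] => //; under eq_bigr do rewrite !big_nil.
  by rewrite sumr_constT mulr_natr.
set P := (fun j => \prod_(y <- s) (1 + t * (g j y - v j))) in hs.
set Q := (fun j => \prod_(y <- s) (1 + t * - (g j y - v j))) in hs.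
have [y hy] := hv (fun j => t * (P j - Q j)).
exists (y :: s) => //.
apply: le_trans hs; rewrite -subr_le0 -sumrB; apply: le_trans hy.
rewrite le_eqVlt; apply/orP; left; apply/eqP.
by apply: eq_bigr => j _; rewrite !big_cons -/(P j) -/(Q j); lra.
Qed.

(** All products in the potential are nonnegative because [t] times a deviation is at most 1/2 in
    absolute value. Each one is therefore bounded by the whole potential, and taking logarithms
    bounds the sums of both signs. *)
Lemma hull_sample_sup (v : J -> R) (t : R) k : in_hull v -> 0 < t <= 1 / 4 ->
  exists2 s : seq Y, size s = k & forall j,
    t * `|\sum_(y <- s) (g j y - v j)| <= ln (2 * #|J|%:R) + 8 * t ^+ 2 * k%:R.
Proof.
move=> hv /andP[t0 t4]; have [s <- hs] := hull_sample_potential t k hv.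
exists s => // j.
have t01 : 0 <= t <= 1 / 4 by rewrite ltW.
have pos (z : R) : `|z| <= 2 -> 0 <= 1 + t * z.
  by rewrite ler_norml => /andP[? ?]; nra.
have dev i y : `|g i y - v i| <= 2 by exact: in_hull_dev.
have devN i y : `|- (g i y - v i)| <= 2 by rewrite normrN.
have posP i (P := fun s : seq Y => \prod_(y <- s) (1 + t * (g i y - v i))) s' : 0 <= P s'.
  by apply: prodr_ge0 => y _; exact: pos.
have posQ i (P := fun s : seq Y => \prod_(y <- s) (1 + t * - (g i y - v i))) s' : 0 <= P s'.
  by apply: prodr_ge0 => y _; exact: pos.
have J0 : (0 < #|J|)%N by apply/card_gt0P; exists j.
have hj : \prod_(y <- s) (1 + t * (g j y - v j)) +
          \prod_(y <- s) (1 + t * - (g j y - v j)) <= 2 * #|J|%:R.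
  apply: le_trans hs; rewrite (bigD1 j) //= lerDl; apply: sumr_ge0 => i _.
  by rewrite addr_ge0.
have N0 : 0 < 2 * #|J|%:R :> R by rewrite mulr_gt0 // ltr0n.
have key (h : Y -> R) : (forall y, `|h y| <= 2) ->
    \prod_(y <- s) (1 + t * h y) <= 2 * #|J|%:R ->
    t * \sum_(y <- s) h y <= ln (2 * #|J|%:R) + 8 * t ^+ 2 * (size s)%:R.
  move=> hh le; rewrite -lerBlDr -ler_expR lnK ?posrE //; apply: le_trans le.
  have := @expR_sum_le_prod t (map h s) t01; rewrite size_map !big_map; apply.
  elim: s {hs hj} => [//|y s ih] x; rewrite in_cons => /orP[/eqP ->//|].
  exact: ih.
rewrite -[t in leLHS](ger0_norm (ltW t0)) -normrM ler_norml; apply/andP; split.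
  rewrite lerNl -mulrN -sumrN; apply: key => //.
  by apply: le_trans hj; rewrite lerDr; exact: posP.
by apply: key => //; apply: le_trans hj; rewrite lerDl; exact: posQ.
Qed.

End Empirical.

(** * Counting separated points of a convex hull *)

Section SeparatedHull.
Variables (R : realType) (J : finType) (Y : Type) (g : J -> Y -> R).
Hypothesis g_le1 : forall j y, `|g j y| <= 1.
Variables (m q k : nat) (pts : 'I_m -> Y) (V : 'I_q -> J -> R) (d : R).
Hypotheses (d_gt0 : 0 < d) (k_gt0 : (0 < k)%N).
Hypothesis pts_net :
  forall y, exists i, forall j, `|g j y - g j (pts i)| <= d / 8.
Hypothesis V_hull : forall a, in_hull g (V a).
Hypothesis V_sep : forall a b, a != b -> exists j, d <= `|V a j - V b j|.

Definition sample_mean (u : k.-tuple 'I_m) (j : J) : R :=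
  (\sum_(i <- u) g j (pts i)) / k%:R.

Lemma sample_net (s : seq Y) : size s = k -> exists u : k.-tuple 'I_m,
  forall (v : J -> R) j, `|sample_mean u j - v j| <=
    d / 8 + `|\sum_(y <- s) (g j y - v j)| / k%:R.
Proof.
move=> sk.
have [u us hu] : exists2 u : seq 'I_m, size u = size s & forall j,
    `|\sum_(i <- u) g j (pts i) - \sum_(y <- s) g j y| <= (size s)%:R * (d / 8).
  elim: s {sk} => [|y s [u us hu]].
    by exists [::] => // j; rewrite !big_nil subrr normr0 mul0r.
  have [i hi] := pts_net y; exists (i :: u); first by rewrite /= us.
  move=> j; rewrite !big_cons opprD addrACA /= -natr1 mulrDl mul1r [leRHS]addrC.
  by apply: le_trans (ler_normD _ _) _; apply: lerD => //; rewrite distrC.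
have uk : size u == k by rewrite us sk.
exists (Tuple uk) => v j; rewrite /sample_mean /=.
have k0 : 0 < k%:R :> R by rewrite ltr0n.
have -> : (\sum_(i <- u) g j (pts i)) / k%:R - v j =
  ((\sum_(i <- u) g j (pts i) - \sum_(y <- s) g j y) +
   \sum_(y <- s) (g j y - v j)) / k%:R.
  rewrite sumrB big_const_seq count_predT sk iter_addr_0.
  by rewrite addrA subrK mulrBl -[v j *+ k]mulr_natr mulfK ?gt_eqF.
rewrite normrM normfV (ger0_norm (ltW k0)).
rewrite ler_pdivrMr // mulrDl divfK ?gt_eqF //.
apply: le_trans (ler_normD _ _) _; rewrite lerD2r; apply: le_trans (hu j) _.
by rewrite sk mulrC.
Qed.

(** Take [t = d / 64], which is at most 1/4 since [d <= 16]. Divided by [t * k], the two terms of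
    [hull_sample_sup] are each at most [d / 8]; with the net error the sample mean is within
    [3 / 8 * d] of [V a], less than half the separation, so it determines [a]. *)
Lemma sup_separated_card : d <= 16 -> (0 < #|J|)%N ->
  512 * ln (2 * #|J|%:R) / d ^+ 2 <= k%:R -> (q <= m ^ k)%N.
Proof.
move=> d2 J0 hk.
have k0 : 0 < k%:R :> R by rewrite ltr0n.
have t0 : 0 < d / 64 by rewrite divr_gt0.
have t01 : 0 < d / 64 <= 1 / 4 by apply/andP; split=> //; lra.
have /choice[u hu] a : exists u : k.-tuple 'I_m,
    forall j, `|sample_mean u j - V a j| <= 3 / 8 * d.
  have [s sk hs] := hull_sample_sup g_le1 k (V_hull a) t01.
  have [u hu] := sample_net sk; exists u => j.
  apply: le_trans (hu _ _) _.
  suff : `|\sum_(y <- s) (g j y - V a j)| / k%:R <= d / 4 by lra.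
  rewrite ler_pdivrMr // -(ler_pM2l t0); apply: le_trans (hs j) _.
  move: hk; rewrite ler_pdivrMr ?exprn_gt0 //; set L := ln _; set K := k%:R.
  by move=> h; lra.
have inj : injective u.
  move=> a b uab; apply/eqP; apply/negPn/negP => /V_sep[j].
  have := hu a j; have := hu b j; rewrite uab !ler_norml.
  move=> /andP[? ?] /andP[? ?]; apply/negP; rewrite -ltNge ltr_norml.
  by apply/andP; split; lra.
by have := leq_card u inj; rewrite card_tuple !card_ord.
Qed.

(* A measure is recovered up to [d] from a sample mean [w] and a code: [0] at
   the coordinates where [w] is [d / 2]-close to it, and otherwise its
   discretised value. Few coordinates are coded by a nonzero letter. *)
Lemma l2_separated_card (K : nat) (l : R) :
  2 / d < K%:R -> 0 <= l ->
  q%:R <= m%:R ^+ k *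
    expR (#|J|%:R * (l * (256 / (k%:R * d ^+ 2)) + K%:R * expR (- l))) :> R.
Proof.
move=> hK l0.
have k0 : 0 < k%:R :> R by rewrite ltr0n.
(* Chebyshev's inequality: at a coordinate where the mean is off by [d / 2], the net accounts for
   only [d / 8], so the sum of deviations is at least [k * d / 8]; the squares add up to at most
   [4 * k * #|J|]. *)
have /choice[u hu] a : exists u : k.-tuple 'I_m,
   \sum_j (d / 2 <= `|sample_mean u j - V a j|)%R%:R <= #|J|%:R * (256 / (k%:R * d ^+ 2)) :> R.
  have [s sk hs] := hull_sample_l2 g_le1 k (V_hull a).
  have [u hu] := sample_net sk; exists u.
  have c0 : 0 < k%:R ^+ 2 * (d ^+ 2 / 64) :> R.
    by rewrite mulr_gt0 ?exprn_gt0 // divr_gt0 ?exprn_gt0.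
  rewrite -(ler_pM2r c0).
  apply: (@le_trans _ _ (4 * k%:R * #|J|%:R)); last first.
    rewrite le_eqVlt; apply/orP; left; apply/eqP.
    have kn0 : (k%:R : R) != 0 by rewrite gt_eqF.
    have dn0 : d != 0 by rewrite gt_eqF.
    rewrite invfM; set D := d ^+ 2; set k' := k%:R.
    have D0 : D * D^-1 = 1 by rewrite divff // expf_neq0.
    have k'0 : k' * k'^-1 = 1 by rewrite divff.
    transitivity (4 * k' * #|J|%:R * (D * D^-1) * (k' * k'^-1)); last by lra.
    by rewrite D0 k'0 !mulr1.
  apply: le_trans hs; rewrite mulr_suml; apply: ler_sum => j _.
  have := hu (V a) j; case: (boolP (d / 2 <= _)) => h h'; last first.
    by rewrite mulr0n mul0r sqr_ge0.
  rewrite mulr1n mul1r -[leRHS]ger0_norm ?sqr_ge0 // normrX.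
  have : k%:R * (d / 8) <= `|\sum_(y <- s) (g j y - V a j)|.
    rewrite mulrC -ler_pdivlMr //; move: (le_trans h h'); set Z := _ / k%:R.
    have := d_gt0; lra.
  move=> h1; apply: (@le_trans _ _ ((k%:R * (d / 8)) ^+ 2)).
    rewrite exprMn ler_pM2l ?exprn_gt0 //. by rewrite !expr2; lra.
  by rewrite lerXn2r ?nnegrE // mulr_ge0 // divr_ge0 // ltW.
pose lev a j := Num.truncn ((V a j + 1) / d).
have levK a j : (lev a j < K)%N.
  rewrite -(ltr_nat R); apply: le_lt_trans hK; rewrite /lev.
  have := in_hull_le1 g_le1 j (V_hull a); rewrite ler_norml => /andP[? ?].
  have h0 : 0 <= (V a j + 1) / d by apply: divr_ge0; [lra|exact: ltW].
  move: (h0); rewrite -truncn_le => h1; apply: le_trans h1 _.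
  rewrite ler_pM2r ?invr_gt0 //.
  lra.
(* Levels are shifted by one because the letter 0 is reserved for coordinates where the mean is
   already good. *)
pose code a : {ffun J -> 'I_K.+1} := [ffun j =>
  if (d / 2 <= `|sample_mean (u a) j - V a j|)%R then inord (lev a j).+1 else ord0].
have codeE a j : (code a j != ord0) = (d / 2 <= `|sample_mean (u a) j - V a j|)%R.
  by rewrite ffunE; case: ifP => // _; rewrite -val_eqE /= inordK ?ltnS ?levK.
(* Equal codes flag the same coordinates. At a flagged one both values lie in the same half-open
   cell of length [d]; elsewhere both are within [d / 2] of the same mean. Either way they are not
   separated. *)
have inj : injective (fun a => (u a, code a)).
  move=> a b [uab /ffunP cab]; apply/eqP; apply/negPn/negP => /V_sep[j].
  have cj := cab j; have ha := codeE a j; have hb := codeE b j.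
  rewrite uab in ha; rewrite cj hb in ha.
  case: (boolP (d / 2 <= `|sample_mean (u b) j - V b j|)) => h.
    rewrite h in ha; move: cj; rewrite !ffunE uab -ha h => /(congr1 val) /=.
    rewrite !inordK ?ltnS ?levK // => -[levab].
    apply/negP; rewrite -ltNge.
    have tr c : (lev c j)%:R * d <= V c j + 1 < (lev c j)%:R * d + d.
      have := in_hull_le1 g_le1 j (V_hull c); rewrite ler_norml => /andP[? ?].
      have h0 : 0 <= (V c j + 1) / d by apply: divr_ge0; [lra|exact: ltW].
      have := truncn_itv h0; rewrite -/(lev c j) ler_pdivlMr // ltr_pdivrMr //.
      by rewrite -[(lev c j).+1%:R]natr1 mulrDl mul1r.
    have := tr a; have := tr b; rewrite levab => /andP[? ?] /andP[? ?].
    by rewrite ltr_norml; apply/andP; split; lra.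
  have h' := h; rewrite ha in h'.
  apply/negP; rewrite -ltNge; move: h h'; rewrite -!ltNge !ltr_norml.
  by move=> /andP[? ?] /andP[? ?]; apply/andP; split; lra.
set tau := 256 / _ in hu *; set N := #|J|%:R in hu *.
(* Exponential weights replace a count of sparse codes. A code that occurs has at most [N * tau]
   nonzero letters, hence weight at least 1, and the total weight factorises over coordinates with
   factors 1 + K exp(-l) <= exp(K exp(-l)). *)
pose w (c : {ffun J -> 'I_K.+1}) : R :=
  expR (N * (l * tau)) * \prod_j expR (- l * (c j != ord0)%:R).
have w0 c : 0 <= w c by rewrite mulr_ge0 ?expR_ge0 ?prodr_ge0 // => j _; exact: expR_ge0.
have w1 a : 1 <= w (code a).
  rewrite /w -expR_sum -expRD -[leLHS]expR0 ler_expR -mulr_sumr.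
  under eq_bigr do rewrite codeE.
  have := ler_wpM2l l0 (hu a); lra.
have qle : q%:R <= \sum_(x : k.-tuple 'I_m * {ffun J -> 'I_K.+1}) w x.2.
  have -> : q%:R = \sum_(a : 'I_q) 1 :> R by rewrite sumr_constT card_ord.
  apply: (@le_trans _ _ (\sum_(a : 'I_q) w (code a))); first exact: ler_sum.
  have -> : \sum_(a : 'I_q) w (code a) =
      \sum_(x in [set (u a, code a) | a in [set: 'I_q]]%SET) w x.2.
    rewrite big_imset /=; first by apply: eq_bigl => a; rewrite inE.
    by move=> a b _ _; exact: inj.
  rewrite [leLHS]big_mkcond /=; apply: ler_sum => x _.
  by case: ifP => // _; exact: w0.
apply: le_trans qle _.
have -> : \sum_(x : k.-tuple 'I_m * {ffun J -> 'I_K.+1}) w x.2 =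
    m%:R ^+ k * \sum_c w c.
  rewrite -(pair_bigA _ (fun _ c => w c)) /= sumr_constT card_tuple card_ord.
  by rewrite -natrX mulr_natl.
rewrite ler_wpM2l ?exprn_ge0 // -mulr_sumr mulrDr expRD.
rewrite ler_wpM2l ?expR_ge0 //.
rewrite -(bigA_distr_bigA (fun _ (i : 'I_K.+1) => expR (- l * (i != ord0)%:R))) /=.
rewrite prodr_const expRM_natl; apply: lerXn2r; rewrite ?nnegrE ?expR_ge0 //.
  by apply: sumr_ge0 => i _; exact: expR_ge0.
rewrite big_ord_recl eqxx /= mulr0 expR0; under eq_bigr do rewrite mulr1.
by rewrite sumr_constT card_ord mulr_natl expR_ge1Dx.
Qed.

End SeparatedHull.

(** First [l] is taken large enough for [K * expR (- l) <= b / 4], then [k] large enough for the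
    other term to be at most [b / 4]. Both depend on [d] and [b] only, and [m ^ k] must supply the
    remaining factor [expR (b / 2 * #|J|)]; whence [c = b / (2 * k)]. *)
Lemma exp_separated_card (R : realType) (d b : R) : 0 < d -> 0 < b ->
  exists2 c : R, 0 < c &
  forall (J : finType) (Y : Type) (g : J -> Y -> R) (m q : nat)
    (pts : 'I_m -> Y) (V : 'I_q -> J -> R),
  (forall j y, `|g j y| <= 1) ->
  (forall y, exists i, forall j, `|g j y - g j (pts i)| <= d / 8) ->
  (forall a, in_hull g (V a)) ->
  (forall a b, a != b -> exists j, d <= `|V a j - V b j|) ->
  expR (b * #|J|%:R) <= q%:R -> expR (c * #|J|%:R) <= m%:R.
Proof.
move=> d0 b0.
pose K := (Num.truncn (2 / d)).+1.
have hK : 2 / d < K%:R by exact: truncnS_gt.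
pose l : R := Num.max 0 (ln (4 * K%:R / b)).
have l0 : 0 <= l by rewrite le_max lexx.
have K0 : 0 < K%:R :> R by rewrite ltr0n.
have hl : K%:R * expR (- l) <= b / 4.
  have : 4 * K%:R / b <= expR l.
    rewrite -[leLHS]lnK ?posrE; last by rewrite divr_gt0 // mulr_gt0.
    by rewrite ler_expR le_max lexx orbT.
  rewrite ler_pdivrMr // => h; rewrite expRN ler_pdivrMr ?expR_gt0 //; lra.
pose k := (Num.truncn (1024 * l / (b * d ^+ 2))).+1.
have k0 : 0 < k%:R :> R by rewrite ltr0n.
have hk : l * (256 / (k%:R * d ^+ 2)) <= b / 4.
  have : 1024 * l / (b * d ^+ 2) <= k%:R by apply/ltW; exact: truncnS_gt.
  have d20 : 0 < d ^+ 2 by rewrite exprn_gt0.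
  rewrite ler_pdivrMr ?mulr_gt0 // => h; rewrite mulrA ler_pdivrMr ?mulr_gt0 //; lra.
exists (b / (2 * k%:R)); first by rewrite divr_gt0 // mulr_gt0.
move=> J Y g m q pts V g1 net hV sep hq.
have := l2_separated_card g1 d0 (ltn0Sn _ : (0 < k)%N) net hV sep hK l0.
set N := #|J|%:R in hq *; have N0 : 0 <= N by [].
move=> /(le_trans hq) h.
have {}h : expR (b * N) <= m%:R ^+ k * expR (N * (b / 2)).
  apply: le_trans h _; rewrite ler_wpM2l ?exprn_ge0 // ler_expR ler_wpM2l //.
  lra.
have kn0 : (0 < k)%N by [].
rewrite -(ler_pXn2r kn0) ?nnegrE ?expR_ge0 // -expRM_natl.
rewrite -(ler_pM2r (expR_gt0 (N * (b / 2)))); apply: le_trans h.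
rewrite -expRD ler_expR.
have -> : k%:R * (b / (2 * k%:R) * N) = b / 2 * N.
  rewrite invfM; have kk : k%:R / k%:R = 1 :> R by rewrite divff ?gt_eqF.
  transitivity (k%:R / k%:R * (b / 2 * N)); first lra.
  by rewrite kk mul1r.
lra.
Qed.

(** * Compactness of the space of Borel probability measures *)

Section ContinuousIntegral.
Variables (R : realType) (X : pmetricType R).
Hypothesis cX : compact [set: X].
Implicit Types (mu nu : borel_prob R X) (f : X -> R).

Definition bint mu f : R := \int[mu]_(x in setT) (f : borel X -> R) x.

Lemma continuous_measurable f : continuous f ->
  measurable_fun setT (f : borel X -> R).
Proof.
move=> cf; apply: (@measurability _ _ (borel X) _ setT f _ (measurable_realfun.RGenOInfty.measurableE R)).
move=> _ [_ [y ->] <-]; rewrite setTI; apply: sub_sigma_algebra.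
by apply: open_comp => [x _|]; [exact: cf|exact: interval_open].
Qed.

Lemma continuous_bounded f : continuous f ->
  exists2 M : R, 0 < M & forall x, `|f x| <= M.
Proof.
move=> cf; have cnf : {within [set: X], continuous (fun x => `|f x|)}.
  apply: continuous_subspaceT => x.
  by apply: cvg_norm; exact: cf.
have [x _ hx] := compact_EVT_max (ex_intro _ point I) cX cnf.
exists (`|f x| + 1) => [|y]; first by rewrite ltr_wpDl.
by rewrite (le_trans (hx y _)) ?inE // lerDl.
Qed.

Lemma continuous_integrable mu f : continuous f ->
  mu.-integrable setT (EFin \o (f : borel X -> R)).
Proof.
move=> cf; apply: measurable_bounded_integrable => //.
- by rewrite -ge0_fin_numE // fin_num_measure.
- exact: continuous_measurable.
- have [M M0 hM] := continuous_bounded cf.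
  exists M; split; first exact: num_real.
  by move=> y My x _; apply: le_trans (hM x) (ltW My).
Qed.

Lemma bint_cst mu (r : R) : bint mu (fun=> r) = r.
Proof.
transitivity (r * fine (mu setT)); first exact: Rintegral_cst.
have -> : mu setT = 1%E by exact: probability_setT.
by rewrite mulr1.
Qed.

Lemma le_bint mu f1 f2 : continuous f1 -> continuous f2 ->
  (forall x, f1 x <= f2 x) -> bint mu f1 <= bint mu f2.
Proof.
by move=> c1 c2 f12; apply: le_Rintegral => //; exact: continuous_integrable.
Qed.

Lemma bintD mu f1 f2 : continuous f1 -> continuous f2 ->
  bint mu (fun x => f1 x + f2 x) = bint mu f1 + bint mu f2.
Proof. by move=> c1 c2; apply: RintegralD => //; exact: continuous_integrable. Qed.

Lemma bintZ mu f (r : R) : continuous f ->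
  bint mu (fun x => r * f x) = r * bint mu f.
Proof. by move=> cf; apply: RintegralZl => //; exact: continuous_integrable. Qed.

Lemma bint_sum mu (J : finType) (c : J -> R) (g : J -> X -> R) :
  (forall j, continuous (g j)) ->
  continuous (fun x => \sum_j c j * g j x) /\
  bint mu (fun x => \sum_j c j * g j x) = \sum_j c j * bint mu (g j).
Proof.
move=> cg; elim: (index_enum J) => [|j s [cs ih]].
  rewrite !big_nil; under eq_fun do rewrite big_nil.
  by rewrite bint_cst; split=> //; exact: cst_continuous.
have cj : continuous (fun x => c j * g j x).
  by move=> x; apply: cvgM; [exact: cvg_cst|exact: cg].
under eq_fun do rewrite big_cons.
rewrite big_cons -ih -bintZ // -bintD //; split=> //.
by move=> x; apply: cvgD; [exact: cj|exact: cs].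
Qed.

(** A linear combination of the [g j] attains its minimum on the compact space, and its integral
    against a probability is at least that minimum. *)
Lemma bint_hull mu (J : finType) (g : J -> X -> R) :
  (forall j, continuous (g j)) -> in_hull g (fun j => bint mu (g j)).
Proof.
move=> cg c; have [ch hh] := bint_sum mu c cg.
have [x _ hx] := compact_EVT_min (ex_intro _ point I) cX (continuous_subspaceT ch).
exists x; under eq_bigr do rewrite mulrBr.
rewrite sumrB -hh subr_le0 -[leLHS](bint_cst mu).
apply: le_bint => //; first exact: cst_continuous.
by move=> y; apply: hx; rewrite inE.
Qed.

(** The topology is pulled back from a product, so convergence is tested one continuous function at
    a time. *)
Lemma borel_prob_cvgP (F : set_system (borel_prob R X)) mu : Filter F ->
  F --> mu <->
  forall f : continuousType X R, bint nu f @[nu --> F] --> bint mu f.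
Proof.
move=> FF; split=> [Fmu f|Fmu].
  have ci := @initial_continuous _ _ (@integral_against R X) mu.
  have cf := @proj_continuous (continuousType X R) (fun=> R) f.
  have h := cvg_trans (cvg_app (@integral_against R X) Fmu) ci.
  exact: cvg_trans (cvg_app (proj f) h) (cf _).
have h : (@integral_against R X) @ F --> integral_against mu.
  apply/cvg_sup => f U [V [[W oW <-] Wf WU]].
  have FW : F [set nu | W (bint nu f)] by apply: Fmu; exact: open_nbhs_nbhs.
  change (F (@integral_against R X @^-1` U)).
  by apply: filterS FW => nu Wnu; exact: WU.
move=> A /= [_ [[B oB <-] Bmu BA]].
have FB : F (@integral_against R X @^-1` B) by apply: h; exact: open_nbhs_nbhs.
exact: filterS FB.
Qed.

End ContinuousIntegral.

(** The sum is the integral of the step function [a \o code], and a uniform error keeps its size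
    when integrated against a probability. *)
Lemma step_integral d (W : measurableType d) (R : realType)
    (P : probability W R) (I : finType) (code : W -> I) (f : W -> R) (a : I -> R)
    (e : R) :
  (forall i, measurable (code @^-1` [set i])) ->
  P.-integrable setT (EFin \o f) ->
  (forall x, `|f x - a (code x)| <= e) ->
  `|\int[P]_(x in setT) f x - \sum_i a i * fine (P (code @^-1` [set i]))| <= e.
Proof.
move=> mcode intf fa.
pose B i : set W := code @^-1` [set i].
pose ind i x : R := \1_(B i) x.
have inti i : P.-integrable setT (EFin \o ind i) by apply: integrable_indic; exact: mcode.
have intai i : P.-integrable setT (EFin \o (fun x => a i * ind i x)).
  exact: (integrableZl measurableT (a i) (inti i)).
have step : P.-integrable setT (EFin \o (fun x => \sum_i a i * ind i x)) /\
    \int[P]_(x in setT) (\sum_i a i * ind i x) =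
    \sum_i a i * fine (P (B i)).
  elim: (index_enum I) => [|i s [ints ih]].
    under [X in EFin \o X]eq_fun do rewrite big_nil.
    split; first exact: finite_measure_integrable_cst.
    rewrite big_nil; under eq_Rintegral do rewrite big_nil.
    by rewrite Rintegral_cst // mul0r.
  under [X in EFin \o X]eq_fun do rewrite big_cons.
  split; first exact: (integrableD measurableT (intai i) ints).
  under eq_Rintegral do rewrite big_cons.
  rewrite RintegralD // ih big_cons RintegralZl //; congr (a i * _ + _).
  by rewrite /Rintegral (integral_indic P measurableT (mcode i)) setIT.
have stepE x : \sum_i a i * ind i x = a (code x).
  rewrite (bigD1 (code x)) //= /ind indicE mem_set // mulr1.
  rewrite big1 ?addr0 // => i ix; rewrite indicE memNset ?mulr0 // => ix'.
  by rewrite -ix' eqxx in ix.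
case: step => ints <-.
have inte : P.-integrable setT (EFin \o (fun=> e)) by exact: finite_measure_integrable_cst.
rewrite ler_distl; apply/andP; split.
  rewrite lerBlDr -[X in _ + X]mulr1.
  have <- : fine (P setT) = 1 by rewrite probability_setT.
  rewrite -Rintegral_cst // -RintegralD //.
  apply: le_Rintegral => //; first exact: (integrableD measurableT intf inte).
  by move=> x _; rewrite stepE; have := fa x; rewrite ler_distl => /andP[]; lra.
rewrite -[X in _ + X]mulr1.
have <- : fine (P setT) = 1 by rewrite probability_setT.
rewrite -Rintegral_cst // -RintegralD //.
apply: le_Rintegral => //; first exact: (integrableD measurableT ints inte).
by move=> x _; rewrite stepE; have := fa x; rewrite ler_distl => /andP[].
Qed.

(** A compact interval provides a cluster point, and a cluster point of an ultrafilter is a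
    limit. *)
Lemma ultra_bounded_cvg (T : Type) (R : realType) (U : set_system T) (u : T -> R)
    (a b : R) : UltraFilter U -> (forall x, a <= u x <= b) ->
  exists l : R, u x @[x --> U] --> l.
Proof.
move=> UU uab; have PU : ProperFilter U by exact: ultra_proper.
have [l [_ cl]] : `[a, b]%classic `&` cluster (u x @[x --> U]) !=set0.
  have Uab : U (u @^-1` `[a, b]%classic).
    by apply: filterE => x /=; rewrite in_itv /=; exact: uab.
  by apply: segment_compact; exact: Uab.
exists l => A lA.
have [//|UA] := in_ultra_setVsetC (u @^-1` A) UU.
by have [y [nAy Ay]] := cl (~` A) A UA lA.
Qed.

(* Binary words list the last letter first. *)
Fixpoint prefix (c : nat -> bool) (k : nat) : seq bool :=
  if k is k'.+1 then c k' :: prefix c k' else [::].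

Lemma size_prefix c k : size (prefix c k) = k.
Proof. by elim: k => //= k ->. Qed.

Lemma eq_prefix c c' k : (forall i, (i < k)%N -> c i = c' i) ->
  prefix c k = prefix c' k.
Proof.
elim: k => //= k ih cc'; rewrite cc' // ih // => i ik.
by apply: cc'; exact: ltnW.
Qed.

Lemma prefix_eq c c' k i : prefix c k = prefix c' k -> (i < k)%N -> c i = c' i.
Proof.
elim: k => //= k ih [e1 e2]; rewrite ltnS leq_eqVlt => /orP[/eqP -> //|].
exact: ih.
Qed.

Lemma prefix_le c c' j k : (j <= k)%N -> prefix c k = prefix c' k ->
  prefix c j = prefix c' j.
Proof.
move=> jk e; apply: eq_prefix => i ij.
by apply: (prefix_eq e); exact: leq_trans jk.
Qed.

Lemma prefix_nbhs (c : cantor_space) k :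
  nbhs c [set c' | prefix c' k = prefix c k].
Proof.
elim: k => [|k ih]; first exact: filterE.
have h : nbhs c [set c' : cantor_space | c' k = c k].
  have pk := @proj_continuous nat (fun=> bool) k c.
  exact: (pk _ (discrete_set1 (c k))).
by apply: filterS2 ih h => c' /= -> ->.
Qed.

(** The cylinders around [c] generate a filter that converges to [c] coordinatewise, hence in the
    product topology. *)
Lemma nbhs_prefix (c : cantor_space) (A : set cantor_space) : nbhs c A ->
  exists k, forall c', prefix c' k = prefix c k -> A c'.
Proof.
pose F := filter_from [set: nat]
  (fun k => [set c' : cantor_space | prefix c' k = prefix c k]).
have FF : Filter F.
  apply: filter_from_filter; first by exists 0%N.
  move=> i j _ _; exists (maxn i j) => // c' h.
  by split; apply: prefix_le h; rewrite ?leq_maxl ?leq_maxr.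
have Fc : F --> c.
  apply/cvg_sup => i U [V [[S oS <-] Sc SU]].
  exists i.+1 => // c' h; apply: SU => /=.
  by rewrite (prefix_eq h).
by move=> /Fc[k _ hk]; exists k => c'; exact: hk.
Qed.

Lemma prefix_closed k (Q : set (seq bool)) :
  closed [set c : cantor_space | Q (prefix c k)].
Proof.
rewrite -openC openE => c /= nQ; apply: filterS (prefix_nbhs c k) => c' /= ->.
exact: nQ.
Qed.

(* [w s] is the mass of the cylinder of [s]: a probability on the Cantor space.
   [word t k] locates [t] in the partition of [[0, 1[] into intervals of these
   lengths. *)
Section UnitIntervalCoding.
Variables (R : realType) (w : seq bool -> R).
Hypothesis w_ge0 : forall s, 0 <= w s.
Hypothesis w_nil : w [::] = 1.
Hypothesis w_cons : forall s, w s = w (false :: s) + w (true :: s).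

Fixpoint left_end (s : seq bool) : R :=
  if s is b :: s' then left_end s' + (if b then w (false :: s') else 0) else 0.

Fixpoint word (t : R) (k : nat) : seq bool :=
  if k is k'.+1 then
    (left_end (word t k') + w (false :: word t k') <= t) :: word t k'
  else [::].

Definition word_path (t : R) : nat -> bool := fun k => head false (word t k.+1).

Lemma prefix_word_path t k : prefix (word_path t) k = word t k.
Proof. by elim: k => //= k ->. Qed.

Lemma size_word t k : size (word t k) = k.
Proof. by rewrite -prefix_word_path size_prefix. Qed.

Lemma word_measurable (s : seq bool) k :
  measurable ([set t | word t k = s] : set (measurableTypeR R)).
Proof.
elim: s k => [|b s ih] [|k] /=.
- by rewrite (_ : [set _ | _] = setT) //; apply/seteqP; split.
- by rewrite (_ : [set _ | _] = set0) //; apply/seteqP; split.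
- by rewrite (_ : [set _ | _] = set0) //; apply/seteqP; split.
set l := left_end s + w (false :: s).
rewrite (_ : [set _ | _] = [set t | word t k = s] `&`
    (if b then `[l, +oo[%classic else `]-oo, l[%classic)).
  apply: measurableI; first exact: ih.
  by case: b; apply: measurable_itv.
apply/seteqP; split=> t /=.
  move=> [eb es]; split=> //; move: eb; rewrite es -/l.
  by case: b => [h|/negbT]; rewrite /= in_itv /= ?andbT // -ltNge.
move=> [ts]; rewrite ts; case: b; rewrite /= in_itv /= ?andbT -/l.
  by move=> ->.
by rewrite ltNge => /negPf ->.
Qed.

(** By [w_cons] the two children tile the interval of their parent, [false] on the left. The
    intersection is there because [word] also codes reals outside the unit interval. *)
Lemma word_itv (s : seq bool) :
  [set t | word t (size s) = s] `&` `[0, 1[%classic =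
    `[left_end s, left_end s + w s[%classic.
Proof.
elim: s => [|b s ih] /=.
  by rewrite w_nil add0r; apply/seteqP; split=> t //= [].
apply/seteqP; split=> t /=.
  move=> [[e ts] t01].
  have : `[left_end s, left_end s + w s[%classic t by rewrite -ih.
  rewrite /= !in_itv /= => /andP[h1 h2]; move: e; rewrite ts.
  case: b => [h|/negbT]; last by rewrite -ltNge addr0 h1.
  by rewrite h -addrA -w_cons.
rewrite in_itv /= => /andP[h1 h2].
have h3 : `[left_end s, left_end s + w s[%classic t.
  rewrite /= in_itv /=; have := w_ge0 (false :: s); have := w_ge0 (true :: s).
  by move: h1 h2; rewrite (w_cons s); case: b => h1 h2 h3 h4; apply/andP; split; lra.
move: h3; rewrite -ih => -[/= ts t01]; split=> //; rewrite ts; congr (_ :: _).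
by case: b h1 h2 => //; rewrite addr0 => _; rewrite ltNge => /negPf.
Qed.

Definition unit_lebesgue : set (measurableTypeR R) -> \bar R :=
  mrestr lebesgue_measure (measurable_itv `[(0 : R), 1[).

HB.instance Definition _ := Measure.on unit_lebesgue.

Let unit_lebesgueT : unit_lebesgue setT = 1%E.
Proof.
rewrite /unit_lebesgue /mrestr setTI lebesgue_measure_itv /= lte_fin ltr01.
by rewrite oppr0 adde0.
Qed.

HB.instance Definition _ :=
  Measure_isProbability.Build _ _ _ unit_lebesgue unit_lebesgueT.

Lemma unit_lebesgue_word (s : seq bool) :
  fine (unit_lebesgue [set t | word t (size s) = s]) = w s.
Proof.
rewrite /unit_lebesgue /mrestr word_itv lebesgue_measure_itv /= lte_fin.
case: ifPn => [_|]; first by rewrite -EFinD /= addrAC subrr add0r.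
(* The degenerate case: the interval is empty and [w s] vanishes. *)
by rewrite ltrDl -leNgt => h; apply/esym/eqP; rewrite eq_le h w_ge0.
Qed.

End UnitIntervalCoding.

(** * Coding a compact metric space by the Cantor space *)

Section WeakLimit.
Variables (R : realType) (X : pmetricType R).
Hypothesis cX : compact [set: X].
Variable phi : cantor_space -> X.
Hypotheses (cphi : continuous phi) (sphi : forall x, exists c, phi c = x).

Definition cylinder_image (s : seq bool) : set X :=
  [set x | exists c, phi c = x /\ prefix c (size s) = s].

(** A measurable selection of codes: the [false] child is taken whenever its image still contains
    [x], so each letter is decided by membership in a closed set. *)
Fixpoint address (x : X) (k : nat) : seq bool :=
  if k is k'.+1 then
    ~~ `[< cylinder_image (false :: address x k') x >] :: address x k'
  else [::].

Lemma size_address x k : size (address x k) = k.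
Proof. by elim: k => //= k ->. Qed.

Lemma address_image x k : cylinder_image (address x k) x.
Proof.
elim: k => [|k [c [cx ck]]] /=; first by have [c] := sphi x; exists c.
case: asboolP => [//|nx] /=; exists c; split=> //=.
move: ck; rewrite size_address => ck; rewrite ck; congr (_ :: _).
apply: contra_notT nx => /negPf ck'; exists c; split=> //=.
by rewrite size_address ck ck'.
Qed.

Lemma cylinder_image_measurable s :
  measurable (cylinder_image s : set (borel X)).
Proof.
have cl : closed (cylinder_image s).
  apply: compact_closed; first exact: metric_hausdorff.
  rewrite (_ : cylinder_image s = phi @` [set c : cantor_space | prefix c (size s) = s]).
    apply: continuous_compact; first exact: continuous_subspaceT.
    apply: (subclosed_compact _ cantor_space_compact) => //.
    exact: (@prefix_closed (size s) [set s]).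
  by apply/seteqP; split=> x [c]; [move=> [<- cs]; exists c|move=> cs <-; exists c].
rewrite -[X in measurable X]setCK; apply: measurableC.
by apply: sub_sigma_algebra; rewrite -closedC setCK.
Qed.

Lemma address_measurable s :
  measurable ([set x | address x (size s) = s] : set (borel X)).
Proof.
elim: s => [|b s ih] /=.
  by rewrite (_ : [set _ | _] = setT) //; apply/seteqP; split.
set A := cylinder_image (false :: s).
have mA : measurable (A : set (borel X)) by exact: cylinder_image_measurable.
rewrite (_ : [set _ | _] = [set x | address x (size s) = s] `&`
    (if b then ~` A else A)).
  by apply: measurableI => //; case: b => //; exact: measurableC.
apply/seteqP; split=> x /=.
  by move=> [eb es]; split=> //; move: eb; rewrite es -/A; case: asboolP; case: b.
by move=> [es]; rewrite es -/A; case: b => Ax; congr (_ :: _); case: asboolP.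
Qed.

(** A representative of the cylinder of [s]: the word is put back in reading order and continued by
    [false]. *)
Definition word_point (s : seq bool) : cantor_space := nth false (rev s).

Lemma prefix_word_point s : prefix (word_point s) (size s) = s.
Proof.
elim: s => //= b s ih; rewrite /word_point rev_cons.
rewrite nth_rcons size_rev ltnn eqxx; congr (_ :: _); rewrite -[RHS]ih.
by apply: eq_prefix => i ilt; rewrite nth_rcons size_rev ilt.
Qed.

(** Uniform continuity of [f \o phi] on the compact Cantor space, with cylinders in the role of
    balls. *)
Lemma prefix_uniform (f : X -> R) (e : R) : continuous f -> 0 < e ->
  exists k, forall c c', prefix c k = prefix c' k -> `|f (phi c) - f (phi c')| <= e.
Proof.
move=> cf e0.
have /compact_near_coveringP/(_ nat \oo (fun k c => forall c',
  prefix c k = prefix c' k -> `|f (phi c) - f (phi c')| <= e)) := cantor_space_compact.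
case=> [c _|k _ hk]; last first.
  by exists k => c c'; apply: (hk k) => //=.
have cc : {for c, continuous (f \o phi)}.
  by apply: continuous_comp; [exact: cphi|exact: cf].
have e20 : 0 < e / 2 by rewrite divr_gt0.
have /nbhs_prefix[k hk] : nbhs c [set c' : cantor_space | `|f (phi c) - f (phi c')| < e / 2].
  by move/cvgrPdist_lt : cc => /(_ _ e20).
exists ([set c' | prefix c' k = prefix c k], [set j | (k <= j)%N]).
  by split; [exact: prefix_nbhs|exists k].
move=> [c1 j] /= [c1k kj] c2 c12.
have h1 := hk _ c1k; have h2 := hk c2; rewrite /= in h1 h2.
have {}h2 := h2 (etrans (esym (prefix_le kj c12)) c1k).
by move: h1 h2; rewrite !ltr_norml ler_norml => /andP[? ?] /andP[? ?];
  apply/andP; split; lra.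
Qed.

(** Up to [e], an integral depends only on the masses of the words of length [k]. The coded space is
    arbitrary because the lemma serves twice: for the unit interval with [word] and for measures on
    [X] with [address]. *)
Lemma coded_integral d (W : measurableType d) (P : probability W R)
    (code : W -> nat -> seq bool) (h : W -> X) (f : X -> R) (e : R) (k : nat) :
  (forall v j, size (code v j) = j) ->
  (forall s, measurable [set v | code v (size s) = s]) ->
  (forall v j, cylinder_image (code v j) (h v)) ->
  P.-integrable setT (EFin \o (f \o h)) ->
  (forall c c', prefix c k = prefix c' k -> `|f (phi c) - f (phi c')| <= e) ->
  `|\int[P]_(v in setT) f (h v) - \sum_(s : k.-tuple bool)
     f (phi (word_point s)) * fine (P [set v | code v (size s) = s])| <= e.
Proof.
move=> sc mc ic intf osc.
have sk v : size (code v k) == k by rewrite sc.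
pose cd v : k.-tuple bool := Tuple (sk v).
have cdE (s : k.-tuple bool) :
    cd @^-1` [set s] = [set v | code v (size s) = s].
  apply/seteqP; split=> v /=; first by move=> <- /=; rewrite sc.
  by rewrite size_tuple => vs; apply: val_inj.
under eq_bigr do rewrite -cdE.
apply: (@step_integral _ _ _ P _ cd (f \o h)
  (fun s : k.-tuple bool => f (phi (word_point s)))) => //.
  by move=> s; rewrite cdE; exact: mc.
move=> v /=; have [c [<- ]] := ic v k; rewrite sc => ck; apply: osc.
by rewrite ck /=; have := prefix_word_point (code v k); rewrite sc => ->.
Qed.

End WeakLimit.

Lemma compact_borel_prob (R : realType) (X : pmetricType R) :
  compact [set: X] -> compact [set: borel_prob R X].
Proof.
move=> cX; rewrite compact_ultra => U UU _.
have PU : ProperFilter U by exact: ultra_proper.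
have [phi cphi] := cantor_surj cX (@metric_hausdorff _ X).
have sphi x : exists c, phi c = x.
  by have [c _ cx] := @surj _ _ _ _ phi x I; exists c.
pose ad := address phi.
pose A s : set (borel X) := [set x | ad x (size s) = s].
have mA s : measurable (A s) by exact: address_measurable.
pose u (mu : borel_prob R X) s := fine (mu (A s)).
have u01 (mu : borel_prob R X) s : 0 <= u mu s <= 1.
  rewrite /u fine_ge0 //= -lee_fin fineK ?fin_num_measure //.
  exact: probability_le1.
have /choice[w hw] s : exists l : R, u mu s @[mu --> U] --> l.
  exact: ultra_bounded_cvg (fun mu => u01 mu s).
have uniq s l : u mu s @[mu --> U] --> l -> w s = l.
  exact: (cvg_unique (@Rhausdorff R) (hw s)).
have w_ge0 s : 0 <= w s.
  rewrite -(cvg_lim (@Rhausdorff R) (hw s)); apply: limr_ge; first exact: cvgP (hw s).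
  by apply: nearW => mu; case/andP: (u01 mu s).
(* Total mass and finite additivity pass to the limit along the ultrafilter, which is what the
   interval coding requires of [w]. *)
have w_nil : w [::] = 1.
  apply: uniq; rewrite (_ : (fun mu => u mu [::]) = cst 1); first exact: cvg_cst.
  apply/funext => mu /=; rewrite /u (_ : A [::] = setT).
    by rewrite (@probability_setT _ _ _ (bp_val mu)).
  by apply/seteqP; split.
have w_cons s : w s = w (false :: s) + w (true :: s).
  apply: uniq; rewrite (_ : (fun mu => u mu s) =
    (fun mu => u mu (false :: s) + u mu (true :: s))); first exact: cvgD.
  apply/funext => mu; rewrite /u -fineD ?fin_num_measure //.
  rewrite -measureU //.
    congr (fine (mu _)); apply/seteqP; split=> x /=.
      by rewrite /A /= => ->; case: (~~ _); [right|left].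
    by rewrite /A /=; case=> -[].
  by apply/seteqP; split=> // x []; rewrite /A /= => -[-> _] [].
pose g (t : measurableTypeR R) : borel X := phi (word_path w t).
have mg : measurable_fun setT g.
  apply: (@measurability _ _ (measurableTypeR R) (borel X) setT g (@open X)) => //.
  move=> _ [V oV <-]; rewrite setTI.
  (* An open set pulled back to the Cantor space is the union of the countably many cylinders inside
     it. *)
  rewrite (_ : g @^-1` V = \bigcup_(s in [set: seq bool])
    (if `[< forall c, prefix c (size s) = s -> V (phi c) >]
     then [set t | word w t (size s) = s] else set0)).
    apply: countable_bigcupT_measurable; first exact: countableP.
    by move=> s; case: asboolP => // _; exact: word_measurable.
  apply/seteqP; split=> t /=.
    move=> Vt; have : nbhs (word_path w t : cantor_space) (phi @^-1` V).
      by apply: cphi; exact: open_nbhs_nbhs.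
    move=> /nbhs_prefix[k hk]; exists (word w t k) => //.
    rewrite asboolT /=; first by rewrite size_word.
    by move=> c; rewrite size_word => ck; apply: hk; rewrite ck prefix_word_path.
  move=> [s _]; case: asboolP => //= hs ts; apply: hs.
  by rewrite prefix_word_path.
pose G : {mfun measurableTypeR R >-> borel X} := mfun_Sub (mem_set mg).
pose P : probability (measurableTypeR R) R := @unit_lebesgue R.
pose nu : borel_prob R X := to_borel_prob (distribution P G).
exists nu; split=> //; apply/borel_prob_cvgP => f; apply/cvgrPdist_le => e e0.
have cf : continuous f by exact: cts_fun.
have e30 : 0 < e / 3 by rewrite divr_gt0.
have [k osc] := prefix_uniform cphi cf e30.
have intg : P.-integrable setT (EFin \o (f \o g)).
  apply: measurable_bounded_integrable => //.
  - by rewrite -ge0_fin_numE // fin_num_measure.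
  - by apply: (measurableT_comp _ mg); exact: continuous_measurable.
  - have [M M0 hM] := continuous_bounded cX cf.
    exists M; split; first exact: num_real.
    by move=> y My x _; apply: le_trans (hM _) (ltW My).
have bnu : bint nu f = \int[P]_(t in setT) f (g t).
  rewrite /bint /Rintegral; congr fine.
  rewrite (eq_measure_integral (distribution P G)); last first.
    by move=> B mB _; exact: borel_restrE.
  rewrite integral_distribution //.
  by apply/measurable_realfun.measurable_EFinP; exact: continuous_measurable.
(* The integrals against [nu] and [mu] are both compared with sums over words having the same values
   [a s]. Only the masses differ, [w s] against [u mu s], and these converge; no relation between
   [w s] and the [nu]-mass of [A s] is involved. *)
pose a (s : k.-tuple bool) : R := f (phi (word_point s)).
have hnu : `|bint nu f - \sum_s a s * w s| <= e / 3.
  rewrite bnu.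
  have := @coded_integral _ _ phi _ _ P (word w) g f _ k (size_word w)
    _ _ intg osc.
  under [in X in _ -> X]eq_bigr do rewrite -(unit_lebesgue_word w_ge0 w_nil w_cons).
  apply.
    by move=> s; exact: word_measurable.
  by move=> t j; exists (word_path w t); rewrite size_word prefix_word_path.
have hmu (mu : borel_prob R X) : `|bint mu f - \sum_s a s * u mu s| <= e / 3.
  have := @coded_integral _ _ phi _ _ mu ad id f _ k (@size_address _ _ phi)
    mA (@address_image _ _ _ sphi) _ osc.
  apply; exact: continuous_integrable.
have cs : \sum_s a s * u mu s @[mu --> U] --> \sum_s a s * w s.
  apply: cvg_big => [|s _]; first exact: add_continuous.
  by apply: cvgM; [exact: cvg_cst|exact: hw].
move/cvgrPdist_le : cs => /(_ _ e30); apply: filterS => mu h.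
move: h (hmu mu) hnu; rewrite !ler_norml => /andP[? ?] /andP[? ?] /andP[? ?].
by apply/andP; split; lra.
Qed.

(** * Metrics compatible with the weak-* topology *)

Section CompatibleMetric.
Variables (R : realType) (X : pmetricType R).
Hypothesis cX : compact [set: X].
Variable rho : borel_prob R X -> borel_prob R X -> R.
Hypothesis rho_compat : compatible_metric rho.
Implicit Types mu nu : borel_prob R X.

Lemma cmetric_nbhs mu r : 0 < r -> nbhs mu [set nu | rho mu nu < r].
Proof.
move=> r0; apply: open_nbhs_nbhs; split; last by rewrite /= (cmetricxx rho_compat).
apply/(cmetric_open rho_compat) => nu /= h.
exists (r - rho mu nu); first by rewrite subr_gt0.
move=> xi /= h'; apply: le_lt_trans (cmetric_triangle rho_compat nu mu xi) _.
by rewrite -ltrBrDl.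
Qed.

Lemma nbhs_cmetric mu A : nbhs mu A ->
  exists2 r, 0 < r & forall nu, rho mu nu < r -> A nu.
Proof.
rewrite nbhsE => -[B [oB Bmu] BA].
have [r r0 hr] := (cmetric_open rho_compat B).1 oB mu Bmu.
by exists r => // nu nur; apply: BA; exact: hr.
Qed.

Lemma bint_continuous (f : X -> R) mu : continuous f ->
  bint nu f @[nu --> mu] --> bint mu f.
Proof.
move=> cf; pose f' : continuousType X R := mkcts cf.
have id : (nbhs mu : set_system _) --> mu by [].
exact: ((borel_prob_cvgP mu _).1 id f').
Qed.

Lemma near_tests mu (s : seq (continuousType X R)) (d : R) : 0 < d ->
  nbhs mu [set nu | forall f, f \in s -> `|bint mu f - bint nu f| < d].
Proof.
move=> d0; elim: s => [|f s ih]; first exact: filterE.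
have hf : nbhs mu [set nu | `|bint mu f - bint nu f| < d].
  by move/cvgrPdist_lt : (bint_continuous (mu := mu) (@cts_fun _ _ f)) => /(_ _ d0).
apply: filterS2 ih hf => nu hs hf g; rewrite in_cons => /orP[/eqP ->//|].
exact: hs.
Qed.

(** Sets cut out by finitely many tests generate a filter, which converges to [mu] because it makes
    every single integral converge. *)
Lemma tests_near mu A : nbhs mu A ->
  exists (s : seq (continuousType X R)) (d : R), 0 < d /\
    forall nu, (forall f, f \in s -> `|bint mu f - bint nu f| < d) -> A nu.
Proof.
pose F := filter_from [set p : seq (continuousType X R) * R | 0 < p.2]
  (fun p => [set nu | forall f, f \in p.1 -> `|bint mu f - bint nu f| < p.2]).
have FF : Filter F.
  apply: filter_from_filter; first by exists ([::], 1) => /=.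
  move=> [s d] [t d'] /= d0 d0'; exists (s ++ t, Num.min d d') => /=.
    by rewrite lt_min d0.
  move=> nu h; split=> f fs; have := h f; rewrite mem_cat fs ?orbT => /(_ isT);
    by rewrite lt_min => /andP[].
have Fmu : F --> mu.
  apply/borel_prob_cvgP => f; apply/cvgrPdist_lt => e e0.
  by exists ([:: f], e) => //= nu; apply; rewrite mem_head.
by move=> /Fmu[[s d] /= d0 h]; exists s, d.
Qed.

(** By contradiction: otherwise pairs at distance at least [e] exist that agree on any finitely many
    tests as closely as desired. Compactness gives a cluster point [mu] of their first components;
    for a suitable pair both components are within [e / 2] of [mu]. *)
Lemma finite_test_seq (e : R) : 0 < e ->
  exists (s : seq (continuousType X R)) (d : R), 0 < d /\
    forall mu nu, (forall f, f \in s -> `|bint mu f - bint nu f| < d) ->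
      rho mu nu < e.
Proof.
move=> e0.
pose G := filter_from [set p : seq (continuousType X R) * R | 0 < p.2]
  (fun p => [set q : borel_prob R X * borel_prob R X |
     forall f, f \in p.1 -> `|bint q.1 f - bint q.2 f| < p.2]).
have GF : Filter G.
  apply: filter_from_filter; first by exists ([::], 1) => /=.
  move=> [s d] [t d'] /= d0 d0'; exists (s ++ t, Num.min d d') => /=.
    by rewrite lt_min d0.
  move=> q h; split=> f fs; have := h f; rewrite mem_cat fs ?orbT => /(_ isT);
    by rewrite lt_min => /andP[].
suff : G [set q | rho q.1 q.2 < e].
  by move=> [[s d] /= d0 h]; exists s, d; split=> // mu nu; exact: (h (mu, nu)).
apply: contrapT => nG.
pose G' := within [set q | ~ rho q.1 q.2 < e] G.
have PG' : ProperFilter G'.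
  split; last exact: within_filter.
  apply: contra_not nG => h.
  have {}h : G [set q | ~ rho q.1 q.2 < e -> False] := h.
  by apply: filterS h => q /contrapT.
have [mu [_ cl]] : [set: borel_prob R X] `&` cluster (fst @ G') !=set0.
  by apply: (compact_borel_prob cX); exact: filterT.
have e20 : 0 < e / 2 by rewrite divr_gt0.
have [s [d [d0 hs]]] := tests_near (cmetric_nbhs mu e20).
(* The tolerance is halved because [q.2] is compared with [mu] through [q.1]. *)
have d20 : 0 < d / 2 by rewrite divr_gt0.
have G'D : G' [set q | (forall f, f \in s -> `|bint q.1 f - bint q.2 f| < d / 2) /\
    ~ rho q.1 q.2 < e].
  by exists (s, d / 2) => //= q h nq; split.
pose E := [set q.1 | q in [set q : borel_prob R X * borel_prob R X |
  (forall f, f \in s -> `|bint q.1 f - bint q.2 f| < d / 2) /\ ~ rho q.1 q.2 < e]].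
have FE : (fst @ G') E by apply: filterS G'D => q hq; exists q.
have [_ [[q [q12 nq] <-] h1]] := cl _ _ FE (near_tests mu s d20).
apply: nq; have r1 : rho mu q.1 < e / 2.
  by apply: hs => f fs; apply: lt_trans (h1 f fs) _; lra.
have r2 : rho mu q.2 < e / 2.
  apply: hs => f fs; have := h1 f fs; have := q12 f fs.
  by rewrite !ltr_norml => /andP[? ?] /andP[? ?]; apply/andP; split; lra.
apply: le_lt_trans (cmetric_triangle rho_compat mu _ _) _.
by rewrite (cmetric_sym rho_compat q.1); lra.
Qed.

Lemma finite_tests (e : R) : 0 < e ->
  exists (L : nat) (F : 'I_L.+1 -> X -> R) (d : R),
  [/\ 0 < d <= 1, forall l, continuous (F l), forall l x, `|F l x| <= 1 &
   forall mu nu, (forall l, `|bint mu (F l) - bint nu (F l)| < d) ->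
      rho mu nu < e].
Proof.
move=> /finite_test_seq[s0 [d [d0 hs0]]].
have c0 : continuous (cst 0 : X -> R) by move=> x; exact: cvg_cst.
(* The zero function makes the list nonempty, so its index type has the form ['I_L.+1]. *)
pose z : continuousType X R := mkcts c0; pose s := z :: s0.
have hs mu nu : (forall f, f \in s -> `|bint mu f - bint nu f| < d) ->
    rho mu nu < e.
  by move=> h; apply: hs0 => f fs; apply: h; rewrite in_cons fs orbT.
pose f (l : 'I_(size s)) := tnth (in_tuple s) l.
have cf l : continuous (f l) by exact: cts_fun.
have /choice[M hM] l : exists m : R, 0 < m /\ forall x, `|f l x| <= m.
  by have [m m0 h] := continuous_bounded cX (cf l); exists m.
(* [B] dominates every bound [M l], so after normalising each test by [M l] the tolerance [d / B]
   still controls the original tests. *)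
pose B := 1 + \sum_l M l.
have B1 : 1 <= B by rewrite lerDl; apply: sumr_ge0 => l _; exact: ltW (hM l).1.
have MB l : M l <= B.
  rewrite /B (bigD1 l) //= addrCA lerDl addr_ge0 //.
  by apply: sumr_ge0 => i _; exact: ltW (hM i).1.
have B0 : 0 < B by apply: lt_le_trans B1.
exists (size s0), (fun l x => (M l)^-1 * f l x), (Num.min 1 (d / B)); split.
- by rewrite lt_min ltr01 divr_gt0 //= ge_min lexx.
- by move=> l x; apply: cvgM; [exact: cvg_cst|exact: cf].
- move=> l x; rewrite normrM normfV (gtr0_norm (hM l).1) mulrC.
  by rewrite (ler_pdivrMr _ _ (hM l).1) mul1r (hM l).2.
move=> mu nu h; apply: hs => g /seq_tnthP[l ->].
have := h l; rewrite !bintZ //; try exact: cf.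
rewrite -mulrBr normrM normfV (gtr0_norm (hM l).1) lt_min => /andP[_].
rewrite mulrC (ltr_pdivrMr _ _ (hM l).1) => /lt_le_trans; apply.
by rewrite mulrAC ler_pdivrMr // ler_wpM2l // ltW.
Qed.

End CompatibleMetric.

(** * Dirac masses and integrals along the induced map *)

Section Dirac.
Variables (R : realType) (X : pmetricType R).

Definition dirac_prob (x : X) : borel_prob R X :=
  to_borel_prob (@dirac _ (borel X) x R : probability (borel X) R).

Lemma bint_dirac (f : X -> R) x : continuous f -> bint (dirac_prob x) f = f x.
Proof.
move=> cf; rewrite /bint /Rintegral.
rewrite (eq_measure_integral (@dirac _ (borel X) x R)); last first.
  by move=> B mB _; exact: borel_restrE.
rewrite integral_dirac //; last first.
  by apply/measurable_realfun.measurable_EFinP; exact: continuous_measurable.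
by rewrite diracT mul1e.
Qed.

Variables (T : X -> X) (cT : continuous T).

Lemma induced_map_dirac x : induced_map cT (dirac_prob x) = dirac_prob (T x).
Proof.
apply: borel_prob_ext => A mA; rewrite induced_mapE //.
have mTA : measurable (T @^-1` A : set (borel X)).
  by rewrite -[_ @^-1` _]setTI; exact: (continuous_measurable_borel cT).
by rewrite [LHS]borel_restrE // [RHS]borel_restrE.
Qed.

Lemma iter_induced_map_dirac k x :
  iter k (induced_map cT) (dirac_prob x) = dirac_prob (iter k T x).
Proof. by elim: k => //= k ->; exact: induced_map_dirac. Qed.

Lemma iter_continuous k : continuous (iter k T).
Proof.
elim: k => [|k ih] x; first exact: cvg_id.
by apply: continuous_comp; [exact: ih|exact: cT].
Qed.

Hypothesis cX : compact [set: X].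

Lemma bint_induced_map mu (f : X -> R) : continuous f ->
  bint (induced_map cT mu) f = bint mu (f \o T).
Proof.
move=> cf; rewrite /bint /Rintegral; congr fine.
rewrite (eq_measure_integral (distribution mu (T : borel X -> borel X))); last first.
  by move=> B mB _; exact: borel_restrE.
rewrite integral_distribution //.
  by apply/measurable_realfun.measurable_EFinP; exact: continuous_measurable.
by apply: continuous_integrable => // x; apply: continuous_comp; [exact: cT|exact: cf].
Qed.

Lemma bint_iter_induced_map mu (f : X -> R) k : continuous f ->
  bint (iter k (induced_map cT) mu) f = bint mu (f \o iter k T).
Proof.
elim: k f => //= k ih f cf; rewrite bint_induced_map // ih //.
by move=> x; apply: continuous_comp; [exact: cT|exact: cf].
Qed.

Variable rho : borel_prob R X -> borel_prob R X -> R.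
Hypothesis rho_compat : compatible_metric rho.

Lemma mdist_continuous (x : X) : continuous (mdist x).
Proof.
move=> y; apply/cvgrPdist_lt => e e0.
have := nbhsx_ballx y e e0; rewrite ballEmdist; apply: filterS => z /= yz.
have := metric_triangle x y z; have := metric_triangle x z y.
rewrite (metric_sym z y) => h1 h2.
by rewrite ltr_norml; apply/andP; split; lra.
Qed.

(** Near [x] the test function [mdist x] does the work: its integral against a Dirac mass at [y] is
    the distance from [x] to [y], so a Dirac mass close to that of [x] sits close to [x]. *)
Lemma dirac_separated (e : R) : 0 < e -> exists2 r, 0 < r &
  forall x y, e <= mdist x y -> r <= rho (dirac_prob x) (dirac_prob y).
Proof.
move=> e0.
pose close r x := forall y, rho (dirac_prob x) (dirac_prob y) < r -> mdist x y < e.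
have F0 : Filter (0 : R)^'+ by exact: filter_filter.
(* The radius runs along [0^'+], so the covering form of compactness turns local radii into one
   valid everywhere. *)
have /compact_near_coveringP/(_ R _ close F0) cov := cX.
suff /cov[r1 /= r10 hr] :
    forall x, [set: X] x -> \forall x' \near x & i \near 0^'+, close i x'.
  have r20 : 0 < r1 / 2 by rewrite divr_gt0.
  have hb : `|0 - r1 / 2| < r1 by rewrite sub0r normrN gtr0_norm //; lra.
  exists (r1 / 2) => // x y exy; rewrite leNgt; apply/negP => lt.
  by have := hr (r1 / 2) hb r20 x I y lt; rewrite ltNge exy.
move=> x _; have e20 : 0 < e / 2 by rewrite divr_gt0.
have : nbhs (dirac_prob x) [set nu | bint nu (mdist x) < e / 2].
  have := bint_continuous (mu := dirac_prob x) (@mdist_continuous x).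
  rewrite bint_dirac; last exact: mdist_continuous.
  by rewrite mdistxx => /cvgr_lt; apply.
move=> /(nbhs_cmetric rho_compat)[r r0 hr].
have r20 : 0 < r / 2 by rewrite divr_gt0.
have dc : dirac_prob x' @[x' --> x] --> dirac_prob x.
  apply/borel_prob_cvgP => f; rewrite bint_dirac; last exact: cts_fun.
  change ((fun x' => bint (dirac_prob x') f) @ x --> f x).
  rewrite (_ : (fun x' => bint (dirac_prob x') f) = f); first exact: cts_fun.
  by apply/funext => y; rewrite bint_dirac //; exact: cts_fun.
exists ([set x' | rho (dirac_prob x) (dirac_prob x') < r / 2 /\ mdist x x' < e / 2],
        [set i | i < r / 2]).
  split=> /=; last exact: nbhs_right_lt.
  apply: filterI; first exact: (dc _ (cmetric_nbhs rho_compat (dirac_prob x) r20)).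
  by have := nbhsx_ballx x (e / 2) e20; rewrite ballEmdist.
move=> [x' i] /= [[h1 h2] h3] y h4.
have : rho (dirac_prob x) (dirac_prob y) < r.
  by apply: le_lt_trans (cmetric_triangle rho_compat (dirac_prob x') _ _) _; lra.
move=> /hr /=; rewrite bint_dirac; last exact: mdist_continuous.
have := metric_triangle x' x y; rewrite (metric_sym x' x); lra.
Qed.

End Dirac.

(** * Positive sequences *)

Section Limsup.
Variable R : realType.
Implicit Types u v : nat -> \bar R.
Local Open Scope ereal_scope.

Lemma limn_esup_ge u c :
  (forall N, exists2 n, (N <= n)%N & c <= u n) -> c <= limn_esup u.
Proof.
move=> h; apply: le_ereal_inf_tmp => _ [V [N _ NV] <-].
have [n Nn cn] := h N; apply: le_trans cn _; apply: ereal_sup_ubound.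
by exists n => //; exact: NV.
Qed.

Lemma limn_esup_le u c N :
  (forall n, (N <= n)%N -> u n <= c) -> limn_esup u <= c.
Proof.
move=> h; apply: (@le_trans _ _ (ereal_sup (u @` [set n | (N <= n)%N]))).
  by apply: ereal_inf_lbound; exists [set n | (N <= n)%N] => //; exists N.
by apply: ge_ereal_sup => _ [n Nn <-]; exact: h.
Qed.

Lemma le_limn_esup_near u v N :
  (forall n, (N <= n)%N -> u n <= v n) -> limn_esup u <= limn_esup v.
Proof.
move=> h; apply: le_ereal_inf_tmp => _ [V [M _ MV] <-].
apply: (@le_trans _ _ (ereal_sup (u @` [set n | (maxn N M <= n)%N]))).
  apply: ereal_inf_lbound; exists [set n | (maxn N M <= n)%N] => //.
  by exists (maxn N M).
apply: ge_ereal_sup => _ [n + <-]; rewrite /= geq_max => /andP[Nn Mn].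
apply: le_trans (h n Nn) _; apply: ereal_sup_ubound.
by exists n => //; exact: MV.
Qed.

Lemma limn_esup_gt u (c : R) : c%:E < limn_esup u ->
  forall N, exists2 n, (N <= n)%N & c%:E < u n.
Proof.
move=> h N; apply: contrapT => nh; move: h; rewrite ltNge => /negP; apply.
apply: (@limn_esup_le _ _ N) => n Nn; rewrite leNgt; apply/negP => cu.
by apply: nh; exists n.
Qed.

Lemma limn_esup_lt u (c : R) : limn_esup u < c%:E ->
  exists N, forall n, (N <= n)%N -> u n < c%:E.
Proof.
move=> h; apply: contrapT => nh; move: h; rewrite ltNge => /negP; apply.
apply: limn_esup_ge => N; apply: contrapT => nN; apply: nh; exists N => n Nn.
by rewrite ltNge; apply/negP => cu; apply: nN; exists n.
Qed.

End Limsup.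

Lemma expRN_cvg0 (R : realType) : expR (- n%:R) @[n --> \oo] --> (0 : R)^'+.
Proof.
move=> A [d /= d0 hd].
exists (Num.truncn d^-1).+1 => // n /= dn; apply: hd => /=; last exact: expR_gt0.
rewrite sub0r normrN gtr0_norm ?expR_gt0 // expRN.
have h : d^-1 < expR n%:R.
  apply: lt_le_trans (truncnS_gt _) _; apply: le_trans (expR_ge1Dx _).
  by rewrite (@le_trans _ _ n%:R) ?ler_nat // lerDr.
by rewrite -[ltRHS]invrK ltf_pV2 ?posrE ?invr_gt0 ?expR_gt0.
Qed.

(** * Scalings and a limit-free form of positive entropy *)

Section Scaling.
Variables (R : realType) (scl : R -> R -> R).
Hypothesis scl_scaling : scaling scl.

Lemma scaling_gt0_exp (a : R) n : 0 <= a -> (0 < n)%N ->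
  0 < scl a (expR (- n%:R)).
Proof.
move=> a0 n0; apply: (scaling_gt0 scl_scaling) => //.
by rewrite expR_gt0 /= -[ltRHS]expR0 ltr_expR oppr_lt0 ltr0n.
Qed.

(** For some [l > 1], [scl a e] is negligible against [scl b (e]^
    l)[, and monotonicity bounds the latter by]scl b e[since]e [^ l <= e]. *)
Lemma scaling_small (a b c : R) : 0 < b -> b < a -> 0 < c ->
  exists N, forall n, (N <= n)%N ->
    scl a (expR (- n%:R)) <= c * scl b (expR (- n%:R)).
Proof.
move=> b0 ba c0; have a0 := lt_trans b0 ba.
suff : \forall e \near (0 : R)^'+, scl a e <= c * scl b e.
  by move=> /expRN_cvg0[N _ hN]; exists N => n Nn; exact: hN.
have [l [l1 hl]] : exists l, 1 < l /\ scl a =o_ (0^'+) (fun e => scl b (e `^ l)).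
  have h := scaling_littleo scl_scaling b0 ba.
  have [l [h1 h2]] : exists l, 1 < l /\
     ((scl a =o_ (0^'+) (fun e : R => scl b (e `^ l))) /\
      (scl a =o_ (0^'+) (fun e : R => scl b e `^ l))).
    by apply: (@filter_ex _ (1 : R)^'+); apply: filterI h; exact: nbhs_right_gt.
  by exists l; case: h2.
have h1 : \forall e \near (0 : R)^'+, 0 < e /\ e < 1.
  by apply: filterI; [exact: nbhs_right_gt|exact: nbhs_right_lt].
apply: filterS2 h1 ((eqoP _ _ _).1 hl c c0) => e [e0 e1].
have el0 : 0 < e `^ l by rewrite powR_gt0.
have ele : e `^ l <= e.
  rewrite -[leRHS](powRr1 (ltW e0)); apply: ger_powR; last exact: ltW.
  by rewrite e0 ltW.
have sa : 0 < scl a e.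
  by apply: (scaling_gt0 scl_scaling); [exact: ltW|rewrite e0].
have sb : 0 < scl b (e `^ l).
  by apply: (scaling_gt0 scl_scaling); [exact: ltW|rewrite el0 (le_lt_trans ele)].
rewrite (gtr0_norm sa) (gtr0_norm sb) => /le_trans; apply.
rewrite (ler_pM2l c0); apply: (scaling_nondecreasing scl_scaling) => //.
exact: ltW.
Qed.

Lemma scl_exponent_gt0 (a : R) : 0 < a ->
  exists N, forall n, (N <= n)%N -> 0 < scl_exponent scl a n.
Proof.
move=> a0.
have : \forall e \near (0 : R)^'+, scl a e < 1.
  by have /cvgr_lt := scaling_cvg0 scl_scaling a0; apply.
move=> /expRN_cvg0[N _ hN]; exists (maxn N 1) => n; rewrite geq_max => /andP[Nn n1].
rewrite /scl_exponent oppr_gt0 ln_lt0 // scaling_gt0_exp ?ltW //=.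
exact: hN.
Qed.

Section Entropy.
Variables (Y : Type) (d : Y -> Y -> R) (T : Y -> Y) (S : nat -> nat).

(** Enumerated families suit the counting arguments better than sets of given cardinality.
    Injectivity is a separate clause because [d] and [e] are arbitrary here. *)
Definition separated_family (n : nat) (e : R) (k : nat) : Prop :=
  exists v : 'I_k -> Y, injective v /\
    forall i j, i != j -> e <= seq_dist d T S n (v i) (v j).

Lemma separated_familyP n e k : separated_family n e k <->
  exists E : set Y, (E #= `I_k)%card /\ seq_separated d T S n e E.
Proof.
split=> [[v [vi vs]]|[E [Ek Es]]].
  exists (range v); split.
    have vT : (range v #= [set: 'I_k])%card.
      by apply: inj_card_eq => i j _ _; exact: vi.
    by apply: (card_eq_trans vT); rewrite card_eq_sym card_II.
  move=> _ _ [i _ <-] [j _ <-] vij; apply: vs; apply/eqP => ij.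
  by apply: vij; rewrite ij.
have [f /bij_inj fi] : exists f : [set: 'I_k] -> E, bijective f.
  apply/card_bijP; apply: (@card_eq_trans _ _ _ _ `I_k).
    by rewrite card_eq_sym card_II.
  by rewrite card_eq_sym.
pose s (i : 'I_k) : [set: 'I_k] := exist _ i (mem_set (I : [set: 'I_k] i)).
have vi : injective (fun i => \val (f (s i))).
  by move=> i j /val_inj /fi /(congr1 val).
exists (fun i => \val (f (s i))); split=> // i j ij; apply: Es.
- exact: set_mem (valP (f (s i))).
- exact: set_mem (valP (f (s j))).
- by move=> /vi ij'; rewrite ij' eqxx in ij.
Qed.

Lemma separated_family_le n e e' k : e <= e' ->
  separated_family n e' k -> separated_family n e k.
Proof.
move=> ee' [v [vi vs]]; exists v; split=> // i j ij.
by apply: le_trans (vs _ _ ij).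
Qed.

Definition frequently_separated (a e : R) : Prop :=
  forall N, exists n k, [/\ (N <= n)%N, separated_family n e k &
    1 <= k%:R * scl a (expR (- n%:R))].

Let u e a n := (sep_number d T S n e * (scl a (expR (- n%:R)))%:E)%E.

Let u_ge a e n k : separated_family n e k -> 0 <= a -> (0 < n)%N ->
  ((k%:R * scl a (expR (- n%:R)))%:E <= u e a n)%E.
Proof.
move=> /separated_familyP hk a0 n0; rewrite EFinM lee_wpmul2r //.
  by rewrite lee_fin ltW // scaling_gt0_exp.
by apply: ereal_sup_ubound; exists k.
Qed.

Let u_gt a e n (c : R) : 0 < c -> 0 <= a -> (0 < n)%N -> (c%:E < u e a n)%E ->
  exists2 k, separated_family n e k & c < k%:R * scl a (expR (- n%:R)).
Proof.
move=> c0 a0 n0 h; have s0 := scaling_gt0_exp a0 n0.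
have : ((c / scl a (expR (- n%:R)))%:E < sep_number d T S n e)%E.
  rewrite ltNge; apply/negP => h'; move: h; rewrite ltNge => /negP; apply.
  rewrite -[X in X%:E](divfK (lt0r_neq0 s0)) EFinM lee_wpmul2r //.
  by rewrite lee_fin ltW.
move=> /ereal_sup_gt[_ [k hk <-]]; rewrite lte_fin ltr_pdivrMr // => ck.
by exists k => //; apply/separated_familyP.
Qed.

Let u_ge0 a e n : 0 <= a -> (0 < n)%N -> (0 <= u e a n)%E.
Proof.
move=> a0 n0; rewrite -[leLHS]/((0 : R)%:E) -(mul0r (scl a (expR (- n%:R)))).
apply: (u_ge (k := 0%N)) => //.
have v0 : 'I_0 -> Y by case.
by exists v0; split=> -[].
Qed.

Let u_homo a e e' n : 0 <= a -> (0 < n)%N -> e <= e' -> (u e' a n <= u e a n)%E.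
Proof.
move=> a0 n0 ee'; rewrite /u lee_wpmul2r ?lee_fin ?(ltW (scaling_gt0_exp _ _)) //.
apply: le_ereal_sup => _ [k /separated_familyP hk <-]; exists k => //.
by apply/separated_familyP; exact: separated_family_le hk.
Qed.

Lemma frequently_separated_le a b e : 0 < b -> b <= a ->
  frequently_separated a e -> frequently_separated b e.
Proof.
move=> b0; rewrite le_eqVlt => /orP[/eqP -> //|ba] h N.
have [M hM] := scaling_small b0 ba ltr01.
have [n [k [+ hk le1]]] := h (maxn N M); rewrite geq_max => /andP[Nn Mn].
exists n, k; split=> //; apply: le_trans le1 _.
by rewrite ler_wpM2l //; have := hM n Mn; rewrite mul1r.
Qed.

(** Positive entropy asks for some exponent only. Halving the exponent turns a positive lower bound
    [c] on the limit superior into the bound 1; conversely, separation at exponent [a] forces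
    [upper_Lambda] to be at least 1 at every positive [b < a]. *)
Lemma upper_seq_entropy_gt0P : (0 < upper_seq_entropy d T scl S)%E <->
  exists a e, [/\ 0 < a, 0 < e & frequently_separated a e].
Proof.
split=> [h|[a [e [a0 e0 h]]]].
  have [a a0 La] : exists2 a : R, 0 < a & upper_Lambda d T scl S a <> 0%E.
    apply: contrapT => nh.
    have all1 (a : R) : 0 < a -> (upper_seq_entropy d T scl S <= a%:E)%E.
      move=> a0; apply: ereal_inf_lbound; exists a => //; split=> //.
      by apply: contrapT => La; apply: nh; exists a.
    have := all1 1 ltr01; move: h all1.
    case: (upper_seq_entropy d T scl S) => [r| |] //; rewrite lte_fin => r0 all1 _.
    have r20 : 0 < r / 2 by rewrite divr_gt0.
    by have := all1 (r / 2) r20; rewrite lee_fin; lra.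
  have [e e0 Le] : exists2 e : R, 0 < e & limn_esup (u e a) <> 0%E.
    apply: contrapT => nh; apply: La; apply: lim_near_cst; first exact: ereal_hausdorff.
    apply: filterS (nbhs_right_gt 0) => e e0.
    by apply: contrapT => Le; apply: nh; exists e.
  have [c c0 cL] : exists2 c : R, 0 < c & (c%:E < limn_esup (u e a))%E.
    have : (0 <= limn_esup (u e a))%E.
      apply: limn_esup_ge => N; exists N.+1 => //.
      by apply: u_ge0 => //; exact: ltW.
    move: Le; case: (limn_esup (u e a)) => [r| |] // Le.
      rewrite lee_fin => r0; exists (r / 2); rewrite ?lte_fin.
        by rewrite divr_gt0 // lt_neqAle r0 andbT; apply/eqP => r0'; apply: Le; rewrite -r0'.
      have : 0 < r by rewrite lt_neqAle r0 andbT; apply/eqP => r0'; apply: Le; rewrite -r0'.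
      lra.
    by exists 1; rewrite ?ltry.
  have a20 : 0 < a / 2 by rewrite divr_gt0.
  have a2 : a / 2 < a by lra.
  exists (a / 2), e; split=> // N.
  have [M hM] := scaling_small a20 a2 c0.
  have [n] := limn_esup_gt cL (maxn (maxn N M) 1); rewrite !geq_max.
  move=> /andP[/andP[Nn Mn] n0] /(u_gt c0 (ltW a0) n0)[k hk ck].
  exists n, k; split=> //; rewrite -(ler_pM2l c0) mulr1.
  apply: le_trans (ltW ck) _; rewrite mulrCA ler_wpM2l //; exact: hM.
apply: (@lt_le_trans _ _ a%:E); first by rewrite lte_fin.
apply: le_ereal_inf_tmp => _ [b [b0 Lb] <-]; rewrite lee_fin leNgt; apply/negP => ba.
have {}h := frequently_separated_le b0 (ltW ba) h.
have homoL e1 e2 : e1 <= e2 -> (limn_esup (u e2 b) <= limn_esup (u e1 b))%E.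
  move=> e12; apply: (@le_limn_esup_near _ _ _ 1%N) => n n0.
  by apply: u_homo => //; exact: ltW.
(* Monotonicity in the separation scale shows that the limit exists, so that [lim] in [upper_Lambda]
   is not a default value. *)
have cvgL : cvg (limn_esup (u e' b) @[e' --> 0^'+]).
  apply: nonincreasing_at_right_is_cvge; apply: filterE => x e1 e2 _ _ e12.
  exact: homoL.
have : (1 <= upper_Lambda d T scl S b)%E.
  apply: lime_ge => //; apply: filterS (nbhs_right_lt e0) => e' e'e.
  apply: limn_esup_ge => N; have [n [k [Nn hk le1]]] := h N.+1.
  have n0 : (0 < n)%N by apply: leq_trans Nn.
  exists n; first exact: ltnW.
  apply: le_trans (u_ge (separated_family_le (ltW e'e) hk) (ltW b0) n0).
  by rewrite lee_fin.
by rewrite Lb lee_fin ler10.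
Qed.

End Entropy.
End Scaling.

Section SequenceMetric.
Variables (R : realType) (Y : Type) (d : Y -> Y -> R) (T : Y -> Y).

Lemma seq_dist_geP (S : nat -> nat) n e x y : 0 < e ->
  e <= seq_dist d T S n x y <->
  exists j : 'I_n, e <= d (iter (S j) T x) (iter (S j) T y).
Proof.
move=> e0; split=> [/bigmax_geP[|[j _ ej]]|[j ej]].
- by move=> /le_lt_trans/(_ e0); rewrite ltxx.
- by exists j.
- by apply/bigmax_geP; right; exists j.
Qed.

Hypotheses (dxx : forall x, d x x = 0) (dC : forall x y, d x y = d y x).

Lemma seq_distC S n x y : seq_dist d T S n x y = seq_dist d T S n y x.
Proof. by apply: eq_bigr => j _; rewrite dC. Qed.

Lemma seq_dist_lt_refl S n e x : 0 < e -> seq_dist d T S n x x < e.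
Proof.
move=> e0; rewrite ltNge; apply/negP => /(seq_dist_geP _ _ _ _ e0)[j].
by rewrite dxx leNgt e0.
Qed.

(* A maximal separated family is a net. *)
Lemma separated_net S n e : 0 < e ->
  (forall k, separated_family d T S n e k) \/
  exists m (v : 'I_m -> Y), separated_family d T S n e m /\
    forall y, exists i, seq_dist d T S n y (v i) < e.
Proof.
move=> e0; have [all|/existsNP nall] :=
  pselect (forall k, separated_family d T S n e k); first by left.
right; have ex : exists k, `[< ~ separated_family d T S n e k >].
  by have [k nk] := nall; exists k; apply/asboolP.
have [k /asboolP nk kmin] := ex_minnP ex.
case: k nk kmin => [nk _|k nk kmin].
  have v0 : 'I_0 -> Y by case.
  by case: nk; exists v0; split=> -[].
(* As [k.+1] is the least size not realised, a family of size [k] exists and no point can be added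
   to it. *)
have : separated_family d T S n e k.
  apply: contrapT => nk'; have := kmin k; rewrite ltnn => h.
  by apply: notF; apply: h; apply/asboolP.
move=> [v [vi vs]]; exists k, v; split; first by exists v.
move=> y; apply: contrapT => /forallNP ny.
have {}ny i : e <= seq_dist d T S n y (v i).
  by rewrite leNgt; apply/negP; exact: ny.
pose v' (i : 'I_k.+1) := if unlift ord_max i is Some j then v j else y.
have vs' i j : i != j -> e <= seq_dist d T S n (v' i) (v' j).
  rewrite /v'; case: unliftP => [i' ->|->]; case: unliftP => [j' ->|->] //.
  - by rewrite (inj_eq lift_inj); exact: vs.
  - by rewrite seq_distC.
  - by rewrite eqxx.
apply: nk; exists v'; split=> // i j vij; apply/eqP/negPn/negP => /vs'.
by rewrite vij leNgt seq_dist_lt_refl.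
Qed.

End SequenceMetric.

(** * Separated measures seen as separated hull vectors *)

Section Transfer.
Variables (R : realType) (X : pmetricType R).
Hypothesis cX : compact [set: X].
Variables (T : X -> X) (cT : continuous T).
Variable rho : borel_prob R X -> borel_prob R X -> R.
Hypothesis rho_compat : compatible_metric rho.

Lemma separated_family_dirac (e : R) : 0 < e -> exists2 r, 0 < r &
  forall S n k, separated_family (@mdist R X) T S n e k ->
    separated_family rho (induced_map cT) S n r k.
Proof.
move=> e0; have [r r0 hr] := dirac_separated cX rho_compat e0.
exists r => // S n k [v [vi vs]].
have vs' i j : i != j ->
    r <= seq_dist rho (induced_map cT) S n (dirac_prob (v i)) (dirac_prob (v j)).
  move=> /vs /(seq_dist_geP _ _ _ _ _ _ e0)[l hl].
  apply/(seq_dist_geP _ _ _ _ _ _ r0); exists l.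
  by rewrite !iter_induced_map_dirac; exact: hr.
exists (fun i => dirac_prob (v i)); split=> // i j vij.
apply/eqP/negPn/negP => /vs'; rewrite vij leNgt seq_dist_lt_refl //.
exact: cmetricxx.
Qed.

Lemma mdist_uniform (L : finType) (F : L -> X -> R) (e : R) :
  (forall l, continuous (F l)) -> 0 < e -> exists2 r, 0 < r &
  forall x y, mdist x y < r -> forall l, `|F l x - F l y| <= e.
Proof.
move=> cF e0.
pose close r x := forall y, mdist x y < r -> forall l, `|F l x - F l y| <= e.
have F0 : Filter (0 : R)^'+ by exact: filter_filter.
have /compact_near_coveringP/(_ R _ close F0) cov := cX.
suff /cov[r1 /= r10 hr] :
    forall x, [set: X] x -> \forall x' \near x & i \near 0^'+, close i x'.
  have r20 : 0 < r1 / 2 by rewrite divr_gt0.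
  have hb : `|0 - r1 / 2| < r1 by rewrite sub0r normrN gtr0_norm //; lra.
  by exists (r1 / 2) => // x y xy; exact: (hr (r1 / 2) hb r20 x I y xy).
move=> x _; have e20 : 0 < e / 2 by rewrite divr_gt0.
have nF : nbhs x [set y | forall l, `|F l x - F l y| < e / 2].
  apply: filter_forall => l.
  by move/cvgrPdist_lt : (cF l x) => /(_ _ e20).
have [r /= r0 hr] := (nbhs_ballP _ _).1 nF.
have r20 : 0 < r / 2 by rewrite divr_gt0.
exists ([set x' | mdist x x' < r / 2], [set i | i < r / 2]).
  split=> /=; last exact: nbhs_right_lt.
  by have := nbhsx_ballx x (r / 2) r20; rewrite ballEmdist.
move=> [x' i] /= [h1 h2] y h3 l; rewrite ballEmdist in hr.
have /hr /(_ l) k1 : [set y | mdist x y < r] x' by rewrite /=; lra.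
have /hr /(_ l) k2 : [set y | mdist x y < r] y.
  by rewrite /=; have := metric_triangle x x' y; lra.
move: k1 k2; rewrite !ltr_norml ler_norml => /andP[? ?] /andP[? ?].
by apply/andP; split; lra.
Qed.

(** Coordinates are pairs of a time and a test function, so their number [n * L.+1] is linear in [n]
    with [L], [d], [r] fixed by [e]. Integrating a test against an iterate of the measure amounts to
    integrating the test composed with an iterate of [T], which puts [V a] in the hull; a maximal
    separated family of [X] provides the net. *)
Lemma separated_family_transfer (e : R) : 0 < e ->
  exists (L : nat) (d r : R), [/\ 0 < d <= 1, 0 < r &
  forall S n q, separated_family rho (induced_map cT) S n e q ->
    (forall k, separated_family (@mdist R X) T S n r k) \/
    exists m, separated_family (@mdist R X) T S n r m /\
    exists (g : 'I_n * 'I_L.+1 -> X -> R) (pts : 'I_m -> X)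
           (V : 'I_q -> 'I_n * 'I_L.+1 -> R),
    [/\ forall j y, `|g j y| <= 1,
        forall y, exists i, forall j, `|g j y - g j (pts i)| <= d / 8,
        forall a, in_hull g (V a) &
        forall a b, a != b -> exists j, d <= `|V a j - V b j|]].
Proof.
move=> e0; have [L [F [d [d01 cF F1 hF]]]] := finite_tests cX rho_compat e0.
have d80 : 0 < d / 8 by case/andP: d01 => d0 _; rewrite divr_gt0.
have [r r0 hr] := mdist_uniform cF d80.
exists L, d, r; split=> // S n q [v [_ vs]].
have [|[m [pts [fm net]]]] :=
  @separated_net _ _ (@mdist R X) T (@mdistxx _ X) (@metric_sym _ X) S n r r0.
  by left.
right; exists m; split=> //.
pose g (j : 'I_n * 'I_L.+1) := F j.2 \o iter (S j.1) T.
have cg j : continuous (g j).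
  by move=> x; apply: continuous_comp; [exact: iter_continuous|exact: cF].
exists g, pts, (fun a j => bint (v a) (g j)); split=> //.
- by move=> j y; exact: F1.
- move=> y; have [i hi] := net y; exists i => j; apply: hr.
  rewrite ltNge; apply/negP => h; move: hi; rewrite ltNge => /negP; apply.
  by apply/(seq_dist_geP _ _ _ _ _ _ r0); exists j.1.
- by move=> a; exact: bint_hull.
move=> a b /vs /(seq_dist_geP _ _ _ _ _ _ e0)[j]; rewrite leNgt => /negP nlt.
apply: contrapT => /forallNP nd; apply: nlt; apply: hF => l.
rewrite !bint_iter_induced_map // ltNge; apply/negP.
exact: (nd (j, l)).
Qed.

End Transfer.

(** * Transfer of positivity from measures to points *)

Section PositiveSequences.
Variables (R : realType) (X : pmetricType R).
Hypothesis cX : compact [set: X].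
Variables (T : X -> X) (cT : continuous T).
Variable rho : borel_prob R X -> borel_prob R X -> R.
Hypothesis rho_compat : compatible_metric rho.
Variable scl : R -> R -> R.
Hypothesis scl_scaling : scaling scl.

Lemma ge1_mul_scaling (a : R) n k : 0 <= a -> (0 < n)%N -> (0 < k)%N ->
  (1 <= k%:R * scl a (expR (- n%:R))) = (scl_exponent scl a n <= ln k%:R).
Proof.
move=> a0 n0 k0; have s0 := scaling_gt0_exp scl_scaling a0 n0.
have p0 : 0 < k%:R * scl a (expR (- n%:R)) by rewrite mulr_gt0 ?ltr0n.
rewrite -[LHS]ler_ln ?posrE // ln1 lnM ?posrE ?ltr0n //.
by rewrite /scl_exponent -[RHS]subr_ge0 opprK.
Qed.

Lemma card_gt0_of_ge1 k (x : R) : 1 <= k%:R * x -> (0 < k)%N.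
Proof. by case: k => //; rewrite mul0r ler10. Qed.

(** From q <= m^k with k <= D log(n+1), the exponent at [a] is at most D log(n+1) log m. The limit
    hypothesis makes it exceed D log(n+1) times the exponent at [b], leaving the latter below log
    m. *)
Lemma log_transfer (a b e : R) S : 0 < b -> b < a -> 0 < e ->
  (scl_exponent scl b n * ln n.+1%:R / scl_exponent scl a n) @[n --> \oo] --> (0 : R) ->
  frequently_separated scl rho (induced_map cT) S a e ->
  exists2 r, 0 < r & frequently_separated scl (@mdist R X) T S b r.
Proof.
move=> b0 ba e0 lim h; have a0 := lt_trans b0 ba.
have [L [d [r [/andP[d0 d1] r0 tr]]]] := separated_family_transfer cX cT rho_compat e0.
exists r => // N.
have l20 : 0 < ln 2 :> R by rewrite ln_gt0 // ltr1n.
have lL0 : 0 <= ln (2 * L.+1%:R) :> R.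
  by rewrite ln_ge0 // -natrM ler1n.
have [C C0 CE] : exists2 C : R, 0 <= C & forall x, 512 * x / d ^+ 2 = C * x.
  exists (512 / d ^+ 2); last by move=> x; rewrite mulrAC.
  by apply: divr_ge0; [exact: ler0n|exact: sqr_ge0].
(* [D] absorbs the constants in k <= C log(2(L+1)n) + 1, using log(n+1) >= log 2 for n >= 1. *)
pose D := C * (ln (2 * L.+1%:R) / ln 2 + 1) + 1 / ln 2.
have D0 : 0 < D.
  apply: ltr_wpDl; last exact: divr_gt0.
  apply: mulr_ge0 => //; apply: addr_ge0 => //.
  by apply: divr_ge0 => //; exact: ltW.
have [N1 hN1] := scl_exponent_gt0 scl_scaling a0.
have [N2 _ hN2] : \forall n \near \oo,
    scl_exponent scl b n * ln n.+1%:R / scl_exponent scl a n < D^-1.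
  by have /cvgr_lt := lim; apply; rewrite invr_gt0.
have [n [q [+ fq le1]]] := h (maxn (maxn N 1) (maxn N1 N2)).
rewrite !geq_max => /andP[/andP[Nn n0] /andP[N1n N2n]].
have sb0 := scaling_gt0_exp scl_scaling (ltW b0) n0.
case: (tr S n q fq) => [all|[m [fm [g [pts [V [g1 net hV sep]]]]]]].
  (* When families of every size exist, one with more than [1 / scl b] members will do. *)
  pose k := (Num.truncn (scl b (expR (- n%:R)))^-1).+1.
  exists n, k; split=> //; rewrite -ler_pdivrMr // mul1r.
  by apply/ltW; exact: truncnS_gt.
exists n, m; split=> //.
have qpos := card_gt0_of_ge1 le1.
rewrite (ge1_mul_scaling (ltW a0) n0 qpos) in le1.
have cJ : #|{: 'I_n * 'I_L.+1}| = (n * L.+1)%N by rewrite card_prod !card_ord.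
have J0 : (0 < #|{: 'I_n * 'I_L.+1}|)%N by rewrite cJ muln_gt0 n0.
pose lJ : R := ln (2 * #|{: 'I_n * 'I_L.+1}|%:R).
pose k := (Num.truncn (C * lJ)).+1.
have qmk : (q <= m ^ k)%N.
  apply: (@sup_separated_card _ _ _ _ g1 m q k pts V d d0) => //; first lra.
  by rewrite CE; apply/ltW; exact: truncnS_gt.
have m0 : (0 < m)%N.
  by have := leq_trans qpos qmk; rewrite expn_gt0 => /orP[].
rewrite (ge1_mul_scaling (ltW b0) n0 m0).
have ln10 : 0 < ln n.+1%:R :> R by rewrite ln_gt0 // ltr1n.
have ln2n : ln 2 <= ln n.+1%:R :> R.
  by rewrite ler_ln ?posrE ?ltr0n // ler_nat.
have kD : k%:R <= D * ln n.+1%:R.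
  have t0 : 0 <= C * lJ.
    by rewrite mulr_ge0 // ln_ge0 // -natrM ler1n muln_gt0 J0.
  rewrite /k -natr1; apply: (@le_trans _ _ (C * lJ + 1)).
    by rewrite lerD2r truncn_le.
  have lnN : lJ <= ln (2 * L.+1%:R) + ln n.+1%:R.
    rewrite /lJ cJ -lnM ?posrE ?mulr_gt0 ?ltr0n //.
    rewrite ler_ln ?posrE ?mulr_gt0 ?ltr0n ?muln_gt0 ?n0 //.
    by rewrite natrM -mulrA ler_wpM2l // mulrC ler_wpM2l // ler_nat.
  have u1 : ln (2 * L.+1%:R) <= ln (2 * L.+1%:R) / ln 2 * ln n.+1%:R :> R.
    by rewrite mulrAC ler_pdivlMr // ler_wpM2l.
  have u2 : 1 <= 1 / ln 2 * ln n.+1%:R :> R.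
    by rewrite mulrAC ler_pdivlMr // mul1r mul1r.
  rewrite /D mulrDl; apply: lerD => //; rewrite -mulrA; apply: ler_wpM2l => //.
  by rewrite mulrDl mul1r; apply: le_trans lnN _; rewrite lerD2r.
have lq : scl_exponent scl a n <= D * ln n.+1%:R * ln m%:R.
  apply: le_trans le1 _; apply: (@le_trans _ _ (k%:R * ln m%:R)).
    rewrite mulr_natl -lnXn ?ltr0n // ler_ln ?posrE ?exprn_gt0 ?ltr0n //.
    by rewrite -natrX ler_nat.
  by rewrite ler_wpM2r // ln_ge0 // ler1n.
have := hN2 n N2n; rewrite /= ltr_pdivrMr ?hN1 // => hb.
rewrite -(ler_pM2r ln10); apply: le_trans (ltW hb) _.
rewrite mulrC ler_pdivrMr //; apply: le_trans lq _.
by rewrite -mulrA mulrC [ln n.+1%:R * _]mulrC.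
Qed.

(** Exponentially many separated measures force exponentially many separated points, at a smaller
    rate [c]. This rate is fixed before the exponent [g], which can then be chosen to grow no faster
    than [c * n]. *)
Lemma exp_transfer (a e b : R) S : 0 < a -> 0 < e -> 0 < b ->
  (exists N, forall n, (N <= n)%N -> b * n%:R <= scl_exponent scl a n) ->
  frequently_separated scl rho (induced_map cT) S a e ->
  exists2 c, 0 < c & forall g, 0 < g ->
    (exists N, forall n, (N <= n)%N -> scl_exponent scl g n <= c * n%:R) ->
    exists2 r, 0 < r & frequently_separated scl (@mdist R X) T S g r.
Proof.
move=> a0 e0 b0 [N1 hN1] h.
have [L [d [r [/andP[d0 d1] r0 tr]]]] := separated_family_transfer cX cT rho_compat e0.
(* There are [n * L.+1] coordinates, so rate [b] per unit of time is rate [b / L.+1] per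
   coordinate. *)
have bL0 : 0 < b / L.+1%:R by rewrite divr_gt0 // ltr0n.
have [c c0 hc] := exp_separated_card d0 bL0.
exists (c * L.+1%:R); first by rewrite mulr_gt0 // ltr0n.
move=> gm gm0 [N2 hN2]; exists r => // N.
have [n [q [+ fq le1]]] := h (maxn (maxn N 1) (maxn N1 N2)).
rewrite !geq_max => /andP[/andP[Nn n0] /andP[N1n N2n]].
have sb0 := scaling_gt0_exp scl_scaling (ltW gm0) n0.
case: (tr S n q fq) => [all|[m [fm [g [pts [V [g1 net hV sep]]]]]]].
  pose k := (Num.truncn (scl gm (expR (- n%:R)))^-1).+1.
  exists n, k; split=> //; rewrite -ler_pdivrMr // mul1r.
  by apply/ltW; exact: truncnS_gt.
exists n, m; split=> //.
have qpos := card_gt0_of_ge1 le1.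
rewrite (ge1_mul_scaling (ltW a0) n0 qpos) in le1.
have cJ : #|{: 'I_n * 'I_L.+1}| = (n * L.+1)%N by rewrite card_prod !card_ord.
have hm : expR (c * (n * L.+1)%:R) <= m%:R :> R.
  rewrite -cJ; apply: (hc _ _ g m q pts V g1 net hV sep).
  rewrite cJ -[leRHS]lnK ?posrE ?ltr0n // ler_expR; apply: le_trans le1.
  apply: le_trans (hN1 n N1n).
  by rewrite natrM mulrACA mulVf ?mulr1 // pnatr_eq0.
have m0 : (0 < m)%N by rewrite -(ltr0n R) (lt_le_trans (expR_gt0 _) hm).
rewrite (ge1_mul_scaling (ltW gm0) n0 m0); apply: le_trans (hN2 n N2n) _.
rewrite -ler_expR [leRHS]lnK ?posrE ?ltr0n //; apply: le_trans hm.
by rewrite ler_expR natrM -!mulrA [n%:R * _]mulrC.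
Qed.

(** A positive sequence needs one witnessing exponent, which may change between the two systems:
    Dirac masses keep it, while the way back replaces it by the [b] that keeps it out of [B_log], or
    by one of small linear growth. *)
Lemma positive_seqs_induced :
  B_log scl = set0 \/
  [/\ B_log scl !=set0,
      ereal_inf [set limn_esup (fun n => (scl_exponent scl c n / n%:R)%:E)
                | c in [set c : R | 0 < c]] = 0%E &
      forall a : R, B_log scl a ->
        (0 < limn_einf (fun n => (scl_exponent scl a n / n%:R)%:E))%E] ->
  positive_seqs (@mdist R X) T scl = positive_seqs rho (induced_map cT) scl.
Proof.
move=> hyp; apply/seteqP; split=> S [incS /(upper_seq_entropy_gt0P scl_scaling)];
    move=> [a [e [a0 e0 h]]]; split=> //; apply/(upper_seq_entropy_gt0P scl_scaling).
  have [r r0 hr] := separated_family_dirac cX cT rho_compat e0.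
  exists a, r; split=> // N; have [n [k [Nn fk le1]]] := h N.
  by exists n, k; split=> //; exact: hr.
have [Ba|nBa] := pselect (B_log scl a); last first.
  have [b [/andP[b0 ba] lim]] : exists b : R, 0 < b < a /\
      (scl_exponent scl b n * ln n.+1%:R / scl_exponent scl a n) @[n --> \oo]
        --> (0 : R).
    by apply: contrapT => nb; apply: nBa.
  have [r r0 hr] := log_transfer b0 ba e0 lim h.
  by exists b, r.
case: hyp => [B0|[_ inf0 /(_ a Ba) einf]]; first by rewrite B0 in Ba.
have [b b0 [N hN]] : exists2 b : R, 0 < b &
    exists N, forall n, (N <= n)%N -> b * n%:R <= scl_exponent scl a n.
  move: einf; rewrite /limn_einf oppe_gt0.
  set l := limn_esup _ => l0.
  have [c c0 lc] : exists2 c : R, 0 < c & (l < (- c)%:E)%E.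
    move: l0; case: l => [r| |] //; last by exists 1; rewrite ?ltNyr.
    rewrite lte_fin => r0; exists (- r / 2); first by rewrite divr_gt0 // oppr_gt0.
    by rewrite lte_fin; lra.
  (* Starting at [N.+1] keeps [n] positive, so that the quotient by [n] can be cleared. *)
  have [N hN] := limn_esup_lt lc; exists c => //; exists N.+1 => n Nn.
  have n0 : 0 < n%:R :> R by rewrite ltr0n (leq_trans _ Nn).
  have := hN n (ltnW Nn); rewrite /= lte_fin ltrN2 ltr_pdivlMr //.
  exact: ltW.
have [c c0 hc] := exp_transfer a0 e0 b0 (ex_intro _ N hN) h.
have : (ereal_inf [set limn_esup (fun n => (scl_exponent scl c n / n%:R)%:E)
    | c in [set c : R | (0 < c)%R]] < c%:E)%E by rewrite inf0 lte_fin.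
move=> /ereal_inf_lt[_ [g /= g0 <-]] /limn_esup_lt[M hM].
have [r r0 hr] : exists2 r, 0 < r & frequently_separated scl (@mdist R X) T S g r.
  apply: hc => //; exists M.+1 => n Mn.
  have n0 : 0 < n%:R :> R by rewrite ltr0n (leq_trans _ Mn).
  have := hM n (ltnW Mn); rewrite lte_fin ltr_pdivrMr //.
  exact: ltW.
by exists g, r.
Qed.

End PositiveSequences.

Unset Implicit Arguments.

Theorem corollary5p12 (R : realType) (X : pmetricType R)
    (cX : compact [set: X]) (T : X -> X) (cT : continuous T)
    (rho : borel_prob R X -> borel_prob R X -> R)
    (rho_compat : compatible_metric rho)
    (scl : R -> R -> R) (scl_scaling : scaling scl) :
  B_log scl = set0 \/
  [/\ B_log scl !=set0,
      ereal_inf [set limn_esup (fun n => (scl_exponent scl c n / n%:R)%:E)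
                | c in [set c : R | 0 < c]] = 0%E &
      forall a : R, B_log scl a ->
        (0 < limn_einf (fun n => (scl_exponent scl a n / n%:R)%:E))%E] ->
  upper_seq_dim (@mdist R X) T scl = upper_seq_dim rho (induced_map cT) scl.
Proof.
(* The dimension depends on the system only through its set of positive sequences. *)
move=> hyp; rewrite /upper_seq_dim.
by rewrite (positive_seqs_induced cX cT rho_compat scl_scaling hyp).
Qed.
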